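(* Let $M$ be the Pascal configuration. The circuit variety $V_{\mathcal C(M)}$ admits the following irreducible decomposition: $$V_{\mathcal C(M)}=V_M\cup V_{U_{2,9}}\cup\bigcup_{i=7}^{9}V_{M(i)}.$$
   Context: The Pascal configuration is the simple rank-three matroid on $[9]=\{1,\dots,9\}$ whose circuits of size three are exactly $\{1,6,8\},\{1,5,7\},\{2,4,7\},\{2,6,9\},\{3,4,8\},\{3,5,9\},\{7,8,9\}$. $U_{2,9}$ is the uniform matroid of rank two on $[9]$. $M(i)$ is the matroid on $[9]$ obtained from $M$ by making $i$ a loop: its circuits are the inclusion-minimal elements of $\mathcal C(M)\cup\{\{i\}\}$, where $\mathcal C(M)$ is the set of circuits of $M$. For a matroid $N$ of rank at most three on $[9]$: $\Gamma_N$ is the set of $\gamma=(\gamma_1,\dots,\gamma_9)\in(\mathbb C^3)^9$ such that a subset of $[9]$ is dependent in $N$ if and only if the corresponding vectors $\gamma_i$ are linearly dependent; $V_N$ (matroid variety) is the Zariski closure of $\Gamma_N$; the circuit variety $V_{\mathcal C(N)}$ is the set of $\gamma\in(\mathbb C^3)^9$ such that for every dependent set of $N$ the corresponding vectors are linearly dependent. An irreducible decomposition is the expression of a variety as the union of its irreducible components. *)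

(* Defs.v *)
From HB Require Import structures.
From mathcomp Require Import all_boot all_order all_algebra.
From mathcomp Require Import mpoly complex reals.

Set Implicit Arguments.
Unset Strict Implicit.
Unset Printing Implicit Defensive.

(* Matroids on a finite type, given by their circuits. *)

Definition circuit_elimination (T : finType) (F : {set {set T}}) : Prop :=
  forall (C D : {set T}) (e : T), C \in F -> D \in F -> C != D ->
    e \in C :&: D -> exists2 E, E \in F & E \subset (C :|: D) :\ e.

Record matroid (T : finType) := Matroid {
  circuits : {set {set T}};
  circuits_neq0 : set0 \notin circuits;
  circuits_clutter : {in circuits &, forall C D : {set T}, C \subset D -> C = D};
  circuits_elim : circuit_elimination circuits }.

Section MatroidNotions.
Variables (T : finType) (N : matroid T).

Definition dependent (S : {set T}) : bool :=
  [exists C in circuits N, C \subset S].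

Definition rank : nat := \max_(S : {set T} | ~~ dependent S) #|S|.

(* no loops and no parallel elements *)
Definition simple : Prop := {in circuits N, forall C : {set T}, 2 < #|C|}.

End MatroidNotions.

Section Uniform.
Variables (T : finType) (r : nat).

Definition uniform_circuits : {set {set T}} := [set C : {set T} | #|C| == r.+1].

Lemma uniform_neq0 : set0 \notin uniform_circuits.
Proof. by rewrite inE cards0. Qed.

Lemma uniform_clutter :
  {in uniform_circuits &, forall C D : {set T}, C \subset D -> C = D}.
Proof.
move=> C D; rewrite !inE => /eqP hC /eqP hD sCD.
by apply/eqP; rewrite eqEcard sCD hC hD leqnn.
Qed.

Lemma ex_subset_card (S : {set T}) k :
  k <= #|S| -> exists2 E : {set T}, #|E| = k & E \subset S.
Proof.
move=> hk; exists [set x in take k (enum S)].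
  rewrite cardsE (card_uniqP _); first by rewrite size_takel // -cardE.
  exact/take_uniq/enum_uniq.
by apply/subsetP=> x; rewrite inE => /mem_take; rewrite mem_enum.
Qed.

Lemma card_elim (C D : {set T}) e k :
  k <= #|C| -> ~~ (D \subset C) -> e \in C -> k <= #|(C :|: D) :\ e|.
Proof.
move=> hC /subsetPn[x xD xC] eC.
have e_in : e \in C :|: D by rewrite inE eC.
rewrite -ltnS -[X in _ < X]add1n.
have <- : #|C :|: D| = 1 + #|(C :|: D) :\ e| by rewrite (cardsD1 e) e_in.
apply: leq_ltn_trans hC _; apply: proper_card; apply/properP.
by split; [exact: subsetUl | exists x; rewrite // inE xD orbT].
Qed.

Lemma uniform_elim : circuit_elimination uniform_circuits.
Proof.
move=> C D e hC hD neCD; rewrite inE => /andP[eC _].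
have [|E hE sE] := @ex_subset_card ((C :|: D) :\ e) r.+1.
  apply: card_elim => //; first by move: hC; rewrite inE => /eqP->.
  by apply: contra neCD => /(uniform_clutter hD hC)->.
by exists E; rewrite // inE hE.
Qed.

Definition uniform : matroid T :=
  Matroid uniform_neq0 uniform_clutter uniform_elim.

End Uniform.

Section MakeLoop.
Variables (T : finType) (N : matroid T) (i : T).

Definition loop_circuits : {set {set T}} :=
  [set C | minset (fun D : {set T} => D \in [set i] |: circuits N) C].

Lemma loop_circuitsP (C : {set T}) : reflect
  (C = [set i] \/ C \in circuits N /\ i \notin C) (C \in loop_circuits).
Proof.
apply: (iffP idP); rewrite inE.
  case/minsetP; rewrite in_setU1 => /orP[/eqP-> _|CN minC]; first by left.
  have [iC|] := boolP (i \in C); last by right.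
  by left; rewrite (minC [set i]) ?setU11 ?sub1set.
case=> [->|[CN iC]]; apply/minsetP; split; rewrite ?in_setU1 ?eqxx ?CN ?orbT //.
  move=> D; rewrite in_setU1 => /orP[/eqP->//|DN].
  rewrite subset1 => /orP[/eqP//|/eqP D0].
  by move: DN; rewrite D0 (negPf (circuits_neq0 N)).
move=> D; rewrite in_setU1 => /orP[/eqP->|DN].
  by rewrite sub1set (negPf iC).
exact: (circuits_clutter DN CN).
Qed.

Lemma loop_neq0 : set0 \notin loop_circuits.
Proof.
apply/loop_circuitsP => -[/setP/(_ i)|[]]; first by rewrite !inE eqxx.
by rewrite (negPf (circuits_neq0 N)).
Qed.

Lemma loop_clutter :
  {in loop_circuits &, forall C D : {set T}, C \subset D -> C = D}.
Proof.
move=> C D; rewrite inE => /minsetP[CN _]; rewrite inE => /minsetP[_ minD].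
exact: minD.
Qed.

Lemma loop_elim : circuit_elimination loop_circuits.
Proof.
move=> C D e /loop_circuitsP[->|[CN iC]] /loop_circuitsP[->|[DN iD]];
  rewrite ?eqxx // !inE.
- by move=> _ /andP[/eqP->]; rewrite (negPf iD).
- by move=> _ /andP[eC /eqP ei]; rewrite -ei eC in iC.
move=> neCD /andP[eC eD].
have [|E EN sE] := circuits_elim CN DN neCD (e := e); first by rewrite inE eC.
exists E => //; apply/loop_circuitsP; right; split=> //.
by apply: contra iC => /(subsetP sE); rewrite !inE (negPf iD) orbF => /andP[].
Qed.

(* the matroid N(i), obtained from N by making i a loop *)
Definition make_loop : matroid T := Matroid loop_neq0 loop_clutter loop_elim.

End MakeLoop.

(* [9] = {1, ..., 9} is represented by 'I_9: the label k stands for the ordinal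
   of value k - 1. *)
Definition point (k : nat) : 'I_9 := inord k.-1.
Definition labelled (s : seq nat) : {set 'I_9} := [set x : 'I_9 | x.+1 \in s].

Definition pascal_triples : seq (seq nat) :=
  [:: [:: 1; 6; 8]; [:: 1; 5; 7]; [:: 2; 4; 7]; [:: 2; 6; 9];
      [:: 3; 4; 8]; [:: 3; 5; 9]; [:: 7; 8; 9]].
Definition pascal_lines : {set {set 'I_9}} :=
  [set:: [seq labelled s | s <- pascal_triples]].

Definition is_pascal (M : matroid 'I_9) : Prop :=
  [/\ simple M, rank M = 3
    & forall C : {set 'I_9}, #|C| = 3 -> (C \in circuits M) = (C \in pascal_lines)].

Section PascalExists.

Let cir : {set {set 'I_9}} := pascal_lines :|:
  [set C : {set 'I_9} | (#|C| == 4) && ~~ [exists L in pascal_lines, L \subset C]].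

Let cirE C : (C \in cir) = (C \in pascal_lines)
  || (#|C| == 4) && ~~ [exists L in pascal_lines, L \subset C].
Proof. by rewrite in_setU; congr (_ || _); rewrite inE. Qed.

Let card_labelled s : #|labelled s| = count (mem s) (iota 1 9).
Proof.
rewrite cardsE cardE /enum_mem size_filter (iotaDl 1 0 9) count_map.
by rewrite -val_enum_ord count_map enumT; apply: eq_count => x.
Qed.

Let labelledI s t : labelled s :&: labelled t = labelled [seq x <- s | x \in t].
Proof. by apply/setP=> x; rewrite !inE mem_filter andbC. Qed.

Let linesP C : reflect (exists2 s, s \in pascal_triples & C = labelled s)
                       (C \in pascal_lines).
Proof. by rewrite inE; apply: mapP. Qed.

Let card_line C : C \in pascal_lines -> #|C| = 3.
Proof.
case/linesP=> s hs ->; rewrite card_labelled; apply/eqP; move: s hs.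
by apply/allP; vm_compute.
Qed.

Let card_lineI C D : C \in pascal_lines -> D \in pascal_lines -> C != D ->
  #|C :&: D| <= 1.
Proof.
case/linesP=> s hs -> /linesP[t ht ->] neq; rewrite labelledI card_labelled.
have {neq}: s != t by apply: contra neq => /eqP->.
apply/implyP; move: t ht; apply/allP; move: s hs; apply/allP.
by vm_compute.
Qed.

Let cir_sub (S : {set 'I_9}) : 4 <= #|S| -> exists2 E, E \in cir & E \subset S.
Proof.
move=> /ex_subset_card[E hE sES].
have [/exists_inP[L hL sLE]|noL] := boolP [exists L in pascal_lines, L \subset E].
  by exists L; [rewrite cirE hL | apply: subset_trans sES].
by exists E; rewrite // cirE hE eqxx noL orbT.
Qed.

Let cir_card C : C \in cir -> 3 <= #|C| <= 4.
Proof. by case/setUP => [/card_line->|]//; rewrite inE => /andP[/eqP->]. Qed.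

Let cir_neq0 : set0 \notin cir.
Proof. by apply/negP => /cir_card; rewrite cards0. Qed.

Let cir_clutter : {in cir &, forall C D : {set 'I_9}, C \subset D -> C = D}.
Proof.
move=> C D hC hD sCD; apply/eqP; rewrite eqEcard sCD /=.
case/setUP: hD => [/card_line->|]; first by case/andP: (cir_card hC).
rewrite inE => /andP[/eqP-> noL]; case/setUP: hC => [hC|].
  by case/negP: noL; apply/exists_inP; exists C.
by rewrite inE => /andP[/eqP->].
Qed.

Let cir_elim : circuit_elimination cir.
Proof.
move=> C D e hC hD neCD eCD; apply: cir_sub.
move: (eCD); rewrite inE => /andP[eC eD].
have nDC : ~~ (D \subset C) by apply: contra neCD => /(cir_clutter hD hC)->.
have nCD : ~~ (C \subset D) by apply: contra neCD => /(cir_clutter hC hD)->.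
case/setUP: (hC) => [lC|]; last first.
  by rewrite inE => /andP[/eqP cC _]; apply: card_elim; rewrite ?cC.
case/setUP: (hD) => [lD|]; last first.
  by rewrite inE => /andP[/eqP cD _]; rewrite setUC; apply: card_elim; rewrite ?cD.
have := cardsUI C D; have := card_lineI lC lD neCD.
rewrite (card_line lC) (card_line lD) (cardsD1 e (C :|: D)) inE eC /=.
case: (#|C :&: D|) => [|[|//]] _; last by rewrite addn1 add1n => -[->].
by rewrite addn0 add1n => -[->].
Qed.

Lemma pascal_exists : exists M : matroid 'I_9, is_pascal M.
Proof.
pose M := Matroid cir_neq0 cir_clutter cir_elim.
have lineM (C : {set 'I_9}) : #|C| = 3 -> (C \in circuits M) = (C \in pascal_lines).
  by move=> cC; rewrite /= cirE cC orbF.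
exists M; split=> //.
  by move=> C /cir_card/andP[].
apply/eqP; rewrite eqn_leq; apply/andP; split.
  apply/bigmax_leqP => S; apply: contraR; rewrite -ltnNge => /cir_sub[E hE sE].
  by apply/exists_inP; exists E.
have c3 : #|labelled [:: 1; 2; 3]| = 3 by rewrite card_labelled.
rewrite -[leqLHS]c3; apply: leq_bigmax_cond; apply/exists_inPn => C CM; apply/negP => sC.
case/andP: (cir_card CM) => c _.
have eC : C = labelled [:: 1; 2; 3] by apply/eqP; rewrite eqEcard sC c3.
move: CM; rewrite lineM eC // => /linesP[s hs e].
have : #|labelled [:: 1; 2; 3] :&: labelled s| <= 2.
  rewrite labelledI card_labelled; move: s hs {e}; apply/allP.
  by vm_compute.
by rewrite -e setIid c3.
Qed.

End PascalExists.

From mathcomp Require Import classical_sets.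
Import GRing.Theory.
Local Open Scope ring_scope.
Local Open Scope classical_set_scope.

(* An element of (K^d)^n is an n x d matrix, its i-th vector being the i-th row;
   the n * d coordinates are listed by mxvec. *)
Section Zariski.
Variables (K : fieldType) (n d : nat).
Implicit Types Z X A : set 'M[K]_(n, d).

Definition zero_locus (P : set {mpoly K[n * d]}) : set 'M[K]_(n, d) :=
  [set g | forall p, P p -> p.@[mxvec g 0] = 0].

Definition zariski_closed Z : Prop := exists P, Z = zero_locus P.

Definition zariski_closure A : set 'M[K]_(n, d) := smallest zariski_closed A.

Definition irreducible Z : Prop :=
  Z !=set0 /\ forall A B, zariski_closed A -> zariski_closed B ->
    Z `<=` A `|` B -> Z `<=` A \/ Z `<=` B.

Definition irreducible_component X Z : Prop :=
  [/\ Z `<=` X, irreducible Z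
    & forall Y, Y `<=` X -> irreducible Y -> Z `<=` Y -> Y = Z].

Definition irreducible_decomposition X (s : seq (set 'M[K]_(n, d))) : Prop :=
  [/\ X = \big[setU/set0]_(Z <- s) Z, uniq s
    & forall Z, irreducible_component X Z <-> Z \in s].

End Zariski.

Section MatroidVarieties.
Variables (K : fieldType) (n : nat) (N : matroid 'I_n).

(* Linear dependence is that of the family (g_i) indexed by i in S, so two equal
   vectors with distinct indices are dependent. *)
Definition lin_dependent (g : 'M[K]_(n, 3)) (S : {set 'I_n}) : bool :=
  ~~ free [seq row i g | i in S].

Definition realization_space : set 'M[K]_(n, 3) :=
  [set g | forall S : {set 'I_n}, dependent N S <-> lin_dependent g S].

Definition matroid_variety : set 'M[K]_(n, 3) :=
  zariski_closure realization_space.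

Definition circuit_variety : set 'M[K]_(n, 3) :=
  [set g | forall S : {set 'I_n}, dependent N S -> lin_dependent g S].

End MatroidVarieties.

Arguments lin_dependent {K n} g S.
Arguments realization_space K {n} N.
Arguments matroid_variety K {n} N.
Arguments circuit_variety K {n} N.

(* Main.v *)
(* The circuit variety of M is cut out by the seven determinants of the lines of M.
   The realizations of M, U_{2,9} and M(i) have polynomial parametrizations; two
   points of such a family are joined by a polynomial curve in the family, so the
   closures are irreducible and contain the families as soon as one realization
   exists, which integer coordinates provide.

   A closed set containing c t for all t <> 0, c a polynomial curve, contains c 0.
   Let g be in the circuit variety. If g_i = 0 for some i in {7, 8, 9}, the four
   lines of M avoiding i form a quadrilateral, which can be moved into general
   position. Otherwise 1, 6, 2, 4, 3, 5 is a closed hexagon whose sides pass in turn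
   through 8, 9, 7, 8, 9, 7. When g_7, g_8, g_9 are pairwise independent and span the
   plane L, either all points lie in L, or those in L can be moved off L, and then
   the intersections of sides parametrize the configuration. When some of g_7, g_8,
   g_9 are parallel, one of them can be moved, some of the six points following it.

   The inclusions between components fail on the integer points: on V_M the points
   1, ..., 6 lie on a conic and satisfy a relation of Menelaus type, on the other
   components some vectors vanish or the rank is at most two. *)
From mathcomp Require Import all_boot all_order all_algebra.
From mathcomp Require Import complex reals.
From mathcomp Require Import boolp classical_sets mpoly ring.
Require Import Defs.

Set Implicit Arguments.
Unset Strict Implicit.
Unset Printing Implicit Defensive.
Import Order.TTheory GRing.Theory Num.Theory.
Local Open Scope ring_scope.

(** * Vectors in three-dimensional space *)

(** The circuit variety only asks sides to be dependent. A side whose ends are parallel, or lie on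
    the line of its diagonal point, satisfies this without being reached by the parametrization, and
    a perturbation has to repair it while keeping all the other incidences. Two features of the
    hexagon make this possible. If some vertex is off the plane of the diagonal points, the cycle of
    incidence equations can be cut there, and a chain of two-term equations always has a nonzero
    solution. If diagonal points are parallel, the two sides through a given one are opposite, so
    each follows it separately while the two remaining vertices stay fixed; vertices that block this
    motion are first pushed towards a neighbour. The motions are stated for an arbitrary predicate
    [Q] on lists that is stable under limits of polynomial curves. Cyclic symmetry then amounts to
    composing [Q] with a rotation of the list. Two equations serve to separate V_M from the rest:
    the conic determinant is identically zero on collinear points, so the Menelaus relation is what
    detects U_{2,9}. *)

Section Vectors.
Variable K : fieldType.
Implicit Types (x y z a b c d : 'rV[K]_3) (k : K).

Definition cross x y : 'rV[K]_3 := \row_(j < 3)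
  [:: x 0 1 * y 0 2 - x 0 2 * y 0 1;
      x 0 2 * y 0 0 - x 0 0 * y 0 2;
      x 0 0 * y 0 1 - x 0 1 * y 0 0]`_j.

Definition det3 x y z : K :=
  x 0 0 * (y 0 1 * z 0 2 - y 0 2 * z 0 1)
  + x 0 1 * (y 0 2 * z 0 0 - y 0 0 * z 0 2)
  + x 0 2 * (y 0 0 * z 0 1 - y 0 1 * z 0 0).

Lemma cross0E x y : cross x y 0 0 = x 0 1 * y 0 2 - x 0 2 * y 0 1.
Proof. by rewrite mxE. Qed.
Lemma cross1E x y : cross x y 0 1 = x 0 2 * y 0 0 - x 0 0 * y 0 2.
Proof. by rewrite mxE. Qed.
Lemma cross2E x y : cross x y 0 2 = x 0 0 * y 0 1 - x 0 1 * y 0 0.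
Proof. by rewrite mxE. Qed.
Definition crossE := (cross0E, cross1E, cross2E).

Lemma vec3P x y :
  x 0 0 = y 0 0 -> x 0 1 = y 0 1 -> x 0 2 = y 0 2 -> x = y.
Proof.
move=> e0 e1 e2; apply/rowP => -[[|[|[|//]]] lt]; [move: e0|move: e1|move: e2];
by congr (_ = _); congr (_ 0 _); apply: val_inj.
Qed.

End Vectors.

Ltac det_ring := rewrite /det3 ?(crossE, mxE); ring.
Ltac vec_ring := apply: vec3P; rewrite /det3 ?(crossE, mxE) /=; ring.

Section VectorTheory.
Variable K : fieldType.
Implicit Types (x y z a b c d v w : 'rV[K]_3) (k : K).

Lemma ord3P (P : 'I_3 -> Prop) : P 0 -> P 1 -> P 2 -> forall j, P j.
Proof.
by move=> P0 P1 P2 [[|[|[|//]]] lt]; [move: P0|move: P1|move: P2];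
   congr P; apply: val_inj.
Qed.

(** Cramer's rule in the two coordinates other than [j], whose minor is [cross x y 0 j]; the failure
    of [z] to lie in the span shows only in coordinate [j]. *)
Lemma cramer x y z j :
  cross x y 0 j *: z
  = cross z y 0 j *: x + cross x z 0 j *: y + det3 x y z *: delta_mx 0 j.
Proof. by elim/ord3P: j; vec_ring. Qed.

Lemma cramer4 x y z w :
  det3 x y z *: w = det3 w y z *: x + det3 x w z *: y + det3 x y w *: z.
Proof. by vec_ring. Qed.

Lemma span2 x y z : cross x y != 0 -> det3 x y z = 0 ->
  exists k l, z = k *: x + l *: y.
Proof.
case/rV0Pn=> j nj d.
exists (cross z y 0 j / cross x y 0 j), (cross x z 0 j / cross x y 0 j).
apply: (scalerI nj); rewrite cramer d scale0r addr0 scalerDr !scalerA.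
by rewrite ![cross x y 0 j * (_ / _)]mulrC !divfK.
Qed.

Lemma crossC x y : cross x y = - cross y x. Proof. by vec_ring. Qed.
Lemma crossxx x : cross x x = 0. Proof. by vec_ring. Qed.
Lemma cross0v x : cross 0 x = 0. Proof. by vec_ring. Qed.
Lemma crossv0 x : cross x 0 = 0. Proof. by vec_ring. Qed.
Lemma crossDl x y z : cross (x + y) z = cross x z + cross y z.
Proof. by vec_ring. Qed.
Lemma crossZl k x z : cross (k *: x) z = k *: cross x z.
Proof. by vec_ring. Qed.

Lemma exists_cross_neq0 x : x != 0 -> exists y, cross y x != 0.
Proof.
move=> x0; apply: contrapT => /forallNP h; case/eqP: x0.
have /rowP h0: cross (delta_mx 0 0) x = 0 by apply/eqP/negPn/negP/h.
have /rowP h1: cross (delta_mx 0 1) x = 0 by apply/eqP/negPn/negP/h.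
have := (h0 1, h0 2, h1 2); rewrite !crossE !mxE /= !(mul0r, mul1r, subr0, sub0r).
by case=> [[/eqP/[!oppr_eq0]/eqP ? ?] /eqP/[!oppr_eq0]/eqP ?]; apply: vec3P; rewrite mxE.
Qed.

(** An auxiliary [z] independent of [y] puts [x] in the span of [z] and [y]; the vanishing cross
    product then kills the coefficient of [z]. *)
Lemma parallel x y : y != 0 -> cross x y = 0 -> exists k, x = k *: y.
Proof.
move=> /exists_cross_neq0[z n] h; have [|k [l e]] := @span2 z y x n.
  have -> : det3 z y x = - (z 0 0 * cross x y 0 0 + z 0 1 * cross x y 0 1
                            + z 0 2 * cross x y 0 2) by det_ring.
  by rewrite h !mxE !mulr0 !addr0 oppr0.
exists l; move/eqP: h; rewrite e crossDl !crossZl crossxx scaler0 addr0.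
by rewrite scaler_eq0 (negPf n) orbF => /eqP->; rewrite scale0r add0r.
Qed.

Lemma dependent2 x y : cross x y = 0 ->
  exists k l, (k != 0) || (l != 0) /\ k *: x + l *: y = 0.
Proof.
have [->|y0] := eqVneq y 0.
  by exists 0, 1; rewrite oner_eq0 orbT scaler0 scale0r addr0.
case/(parallel y0) => k ->; exists 1, (- k).
by rewrite oner_eq0 scale1r scaleNr subrr.
Qed.

Lemma det3_eq0P x y z : det3 x y z = 0 <->
  exists k l m, [|| k != 0, l != 0 | m != 0] /\ k *: x + l *: y + m *: z = 0.
Proof.
split=> [d|[k [l [m [n e]]]]].
  have [h|h] := eqVneq (cross x y) 0.
    have [k [l [n e]]] := dependent2 h.
    by exists k, l, 0; rewrite scale0r addr0 e eqxx orbF.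
  have [k [l ->]] := span2 h d; exists k, l, (- 1).
  by rewrite oppr_eq0 oner_eq0 !orbT scaleN1r subrr.
have hx : k * det3 x y z = det3 (k *: x + l *: y + m *: z) y z by det_ring.
have hy : l * det3 x y z = det3 x (k *: x + l *: y + m *: z) z by det_ring.
have hz : m * det3 x y z = det3 x y (k *: x + l *: y + m *: z) by det_ring.
move: hx hy hz; rewrite e => hx hy hz; case/or3P: n => n; apply: (mulfI n);
  by rewrite ?(hx, hy, hz); det_ring.
Qed.

(** The left side is the usual formula for the intersection of the projective lines [a b] and
    [c d]. *)
Lemma cross_cross a b c d :
  cross (cross a b) (cross c d) = det3 a b d *: c - det3 a b c *: d.
Proof. by vec_ring. Qed.

Lemma meetP a b c d x : det3 a b x = 0 -> det3 c d x = 0 ->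
  cross (cross a b) (cross c d) != 0 ->
  exists k, x = k *: cross (cross a b) (cross c d).
Proof.
move=> h1 h2 n; apply: parallel => //.
have -> : cross x (cross (cross a b) (cross c d))
  = det3 c d x *: cross a b - det3 a b x *: cross c d by vec_ring.
by rewrite h1 h2 !scale0r subr0.
Qed.

(** Two linear equations in three unknowns have a nonzero solution. The intersection formula gives
    one unless the normals are parallel; then any nonzero vector orthogonal to the surviving normal
    will do. *)
Lemma exists_perp a b c d :
  exists v, [/\ v != 0, det3 a b v = 0 & det3 c d v = 0].
Proof.
have [h|h] := eqVneq (cross (cross a b) (cross c d)) 0; last first.
  by exists (cross (cross a b) (cross c d)); split=> //; det_ring.
have dE x y z : det3 x y z = cross x y 0 0 * z 0 0 + cross x y 0 1 * z 0 1
                             + cross x y 0 2 * z 0 2 by det_ring.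
have [n|n] := eqVneq (cross c d) 0.
  have [n'|n'] := eqVneq (cross a b) 0.
    exists (delta_mx 0 0); rewrite !dE n n' !mxE !mul0r !addr0; split=> //.
    by apply/rV0Pn; exists 0; rewrite mxE oner_eq0.
  have [y hy] := exists_cross_neq0 n'; exists (cross y (cross a b)).
  by split=> //; [det_ring|rewrite !dE n !mxE !mul0r !addr0].
have [k e] := parallel n h; have [y hy] := exists_cross_neq0 n.
exists (cross y (cross c d)); split=> //; last by det_ring.
rewrite dE e.
have -> // : forall u : 'rV[K]_3, (k *: u) 0 0 * cross y u 0 0 + (k *: u) 0 1 * cross y u 0 1
    + (k *: u) 0 2 * cross y u 0 2 = 0 by move=> u; rewrite !crossE !mxE; ring.
Qed.

Lemma relation4 a b c d : exists k l m n, [|| k != 0, l != 0, m != 0 | n != 0]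
  /\ k *: a + l *: b + m *: c + n *: d = 0.
Proof.
have [/det3_eq0P[k [l [m [h e]]]]|h] := eqVneq (det3 a b c) 0.
  exists k, l, m, 0; rewrite scale0r addr0 e; split=> //.
  by case/or3P: h => ->; rewrite ?orbT.
exists (det3 d b c), (det3 a d c), (det3 a b d), (- det3 a b c).
by rewrite oppr_eq0 h !orbT scaleNr -cramer4 subrr.
Qed.

End VectorTheory.

(** * Polynomial functions and curves *)

(* A class of K-valued functions containing the constants and closed under the
   ring operations: polynomial functions of one parameter, or of the entries of
   a matrix. *)
Record ring_closed (K : fieldType) T (P : (T -> K) -> Prop) := RingClosed {
  rc_cst : forall k, P (fun=> k);
  rc_add : forall f g, P f -> P g -> P (fun t => f t + g t);
  rc_mul : forall f g, P f -> P g -> P (fun t => f t * g t) }.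

Section RingClosed.
Variables (K : fieldType) (T : Type) (P : (T -> K) -> Prop) (hP : ring_closed P).
Implicit Types (f g : T -> K) (x y z : T -> 'rV[K]_3).

Definition on_entries m n (A : T -> 'M[K]_(m, n)) : Prop :=
  forall i j, P (fun t => A t i j).

Lemma rc_opp f : P f -> P (fun t => - f t).
Proof.
move=> hf; have := rc_mul hP (rc_cst hP (- 1)) hf.
by congr P; apply: funext => t; rewrite mulN1r.
Qed.

Lemma rc_sub f g : P f -> P g -> P (fun t => f t - g t).
Proof. by move=> hf /rc_opp; apply: rc_add hP _ _ hf. Qed.

Lemma rc_sum I (r : seq I) (F : I -> T -> K) :
  (forall i, P (F i)) -> P (fun t => \sum_(i <- r) F i t).
Proof.
move=> hF; elim: r => [|i r IH].
  by under eq_fun do rewrite big_nil; apply: rc_cst.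
by under eq_fun do rewrite big_cons; apply: rc_add.
Qed.

Lemma rc_prod I (r : seq I) (F : I -> T -> K) :
  (forall i, P (F i)) -> P (fun t => \prod_(i <- r) F i t).
Proof.
move=> hF; elim: r => [|i r IH].
  by under eq_fun do rewrite big_nil; apply: rc_cst.
by under eq_fun do rewrite big_cons; apply: rc_mul.
Qed.

Lemma rc_exp f n : P f -> P (fun t => f t ^+ n).
Proof.
move=> hf; elim: n => [|n IH].
  by under eq_fun do rewrite expr0; apply: rc_cst.
by under eq_fun do rewrite exprS; apply: rc_mul.
Qed.

Lemma rc_mxcst m n (A : 'M[K]_(m, n)) : on_entries (fun=> A).
Proof. by move=> i j; apply: rc_cst. Qed.

Lemma rc_mxadd m n (A B : T -> 'M[K]_(m, n)) :
  on_entries A -> on_entries B -> on_entries (fun t => A t + B t).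
Proof.
move=> hA hB i j; under eq_fun do rewrite mxE.
exact: (rc_add hP (hA i j) (hB i j)).
Qed.

Lemma rc_mxopp m n (A : T -> 'M[K]_(m, n)) :
  on_entries A -> on_entries (fun t => - A t).
Proof. by move=> hA i j; under eq_fun do rewrite mxE; apply: rc_opp (hA i j). Qed.

Lemma rc_mxscale m n f (A : T -> 'M[K]_(m, n)) :
  P f -> on_entries A -> on_entries (fun t => f t *: A t).
Proof.
by move=> hf hA i j; under eq_fun do rewrite mxE; apply: (rc_mul hP hf (hA i j)).
Qed.

Lemma rc_mxmul m n p (A : T -> 'M[K]_(m, n)) (B : T -> 'M[K]_(n, p)) :
  on_entries A -> on_entries B -> on_entries (fun t => A t *m B t).
Proof.
move=> hA hB i j; under eq_fun do rewrite mxE.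
by apply: rc_sum => k; apply: (rc_mul hP (hA i k) (hB k j)).
Qed.

Lemma rc_det n (A : T -> 'M[K]_n) : on_entries A -> P (fun t => \det (A t)).
Proof.
move=> hA; rewrite /determinant; apply: rc_sum => s.
by apply: rc_mul hP _ _ (rc_cst hP _) _; apply: rc_prod => i; apply: hA.
Qed.

Lemma rc_det3 x y z : on_entries x -> on_entries y -> on_entries z ->
  P (fun t => det3 (x t) (y t) (z t)).
Proof.
move=> hx hy hz; rewrite /det3.
by do ![apply: rc_sub | apply: (rc_add hP) | apply: (rc_mul hP)];
  first [apply: hx | apply: hy | apply: hz].
Qed.

Lemma rc_cross x y : on_entries x -> on_entries y ->
  on_entries (fun t => cross (x t) (y t)).
Proof.
move=> hx hy i j; rewrite ord1 {i}; elim/ord3P: j; under eq_fun do rewrite crossE;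
by do ![apply: rc_sub | apply: (rc_add hP) | apply: (rc_mul hP)];
  first [apply: hx | apply: hy].
Qed.

End RingClosed.

Section PolynomialFunctions.
Variable K : numFieldType.
Implicit Types (f g : K -> K).

Definition polyf f : Prop := exists p : {poly K}, forall t, f t = p.[t].

Lemma polyf_id : polyf (fun t => t).
Proof. by exists 'X => t; rewrite hornerX. Qed.

Lemma polyf_ring : ring_closed polyf.
Proof.
split=> [k|f g [p hp] [q hq]|f g [p hp] [q hq]].
- by exists k%:P => t; rewrite hornerC.
- by exists (p + q) => t; rewrite hornerD hp hq.
- by exists (p * q) => t; rewrite hornerM hp hq.
Qed.

Lemma poly_horner0 (p : {poly K}) : (forall t, p.[t] = 0) -> p = 0.
Proof.
move=> h; apply/eqP/negPn/negP => p0.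
have /negP[] := ltnn (size p).
(* In characteristic zero the integers below [size p] are distinct roots, one more than the degree
   allows. *)
rewrite -{1}(size_iota 0 (size p)) -(size_map (fun i => i%:R : K)).
apply: max_poly_roots => //; first by apply/allP => x _; apply/rootP.
by rewrite map_inj_uniq ?iota_uniq // => i j /eqP; rewrite eqr_nat => /eqP.
Qed.

(** Two nonempty open subsets of the affine line meet. The irreducibility of each matroid variety is
    pulled back to this fact along curves. *)
Lemma polyf_mul_neq0 f g a b : polyf f -> polyf g -> f a != 0 -> g b != 0 ->
  exists t, f t * g t != 0.
Proof.
move=> [p hp] [q hq] fa gb; apply: contrapT => /forallNP h.
have /eqP: p * q = 0.
  apply: poly_horner0 => t; rewrite hornerM -hp -hq.
  by apply/eqP/negPn/negP/h.
rewrite mulf_eq0 => /orP[] /eqP e.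
  by move: fa; rewrite hp e horner0 eqxx.
by move: gb; rewrite hq e horner0 eqxx.
Qed.

Definition curve m n := on_entries polyf (m := m) (n := n).

End PolynomialFunctions.

Ltac poly_fun := repeat first
  [ assumption
  | exact: polyf_id
  | exact: (rc_cst (polyf_ring _))
  | exact: (rc_mxcst (polyf_ring _))
  | apply: (rc_mxadd (polyf_ring _))
  | apply: (rc_mxopp (polyf_ring _))
  | apply: (rc_mxscale (polyf_ring _))
  | apply: (rc_cross (polyf_ring _))
  | apply: (rc_add (polyf_ring _))
  | apply: (rc_opp (polyf_ring _))
  | apply: (rc_mul (polyf_ring _)) ].

(** * Predicates stable under limits along polynomial curves *)

Section CurveClosed.
Variable K : numFieldType.
Implicit Types (fs : seq (K -> 'rV[K]_3)) (s : seq 'rV[K]_3).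
Implicit Types Q : seq 'rV[K]_3 -> Prop.

Definition curves fs : Prop := foldr (fun f P => curve f /\ P) True fs.

(** All that the perturbation arguments see of the Zariski topology. Lists leave the assignment of
    labels to vectors open until the end. *)
Definition curve_closed Q : Prop := forall fs s, curves fs ->
  [seq f 0 | f <- fs] = s -> (forall t, t != 0 -> Q [seq f t | f <- fs]) -> Q s.

Lemma curves_nth fs i : curves fs -> curve (nth (fun=> 0) fs i).
Proof.
elim: fs i => [|f fs IH] [|i] //=; try by move=> _; poly_fun.
  by case.
by case=> _ /IH.
Qed.

(** This is what allows the cyclic symmetries to be used; an index out of range reads the constant
    zero curve. *)
Lemma curve_closed_reindex Q (r : seq nat) :
  curve_closed Q -> curve_closed (fun s => Q [seq nth 0 s i | i <- r]).
Proof.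
have ev fs t i : nth 0 [seq f t | f <- fs] i = nth (fun=> 0) fs i t.
  have [h|h] := ltnP i (size fs); first by rewrite (nth_map (fun=> 0)).
  by rewrite !nth_default ?size_map.
move=> Qc fs s cfs <- h.
apply: (Qc [seq nth (fun=> 0) fs i | i <- r]).
- by elim: r {h} => //= i r IH; split=> //; apply: curves_nth.
- by rewrite -map_comp; apply: eq_map => i /=; rewrite ev.
- move=> t /h; congr Q; rewrite -map_comp; apply: eq_map => i /=.
  by rewrite ev.
Qed.

(** No bound on [i] is required, because the default value 0 lies in every span. *)
Definition spanned s (a b : 'rV[K]_3) : Prop :=
  forall i, exists k l, nth 0 s i = k *: a + l *: b.

Definition planar s : Prop := exists a b, spanned s a b.

Lemma spanned_nil a b : spanned [::] a b.
Proof. by move=> i; exists 0, 0; rewrite nth_nil !scale0r addr0. Qed.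

Lemma spanned_cons x s a b : cross a b != 0 ->
  det3 a b x = 0 -> spanned s a b -> spanned (x :: s) a b.
Proof. by move=> ab d h [|i] /=; [apply: span2|apply: h]. Qed.

End CurveClosed.

Lemma det3_swapl (K : fieldType) (x y z : 'rV[K]_3) : det3 y x z = - det3 x y z.
Proof. by det_ring. Qed.

Lemma det3_swapr (K : fieldType) (x y z : 'rV[K]_3) : det3 x z y = - det3 x y z.
Proof. by det_ring. Qed.

Lemma det3_scale (K : fieldType) k l m (x y z : 'rV[K]_3) :
  det3 (k *: x) (l *: y) (m *: z) = k * l * m * det3 x y z.
Proof. by det_ring. Qed.

(** * Hexagons whose sides pass through three collinear points *)

Section DistinctDiagonalPoints.
Variable K : numFieldType.
Implicit Types (x c n d : nat -> 'rV[K]_3) (h p q : nat -> K).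
Variables A B : 'rV[K]_3.
(** The plane of the diagonal points is the kernel of [l]. In the affine chart [l = 1] it becomes
    the line at infinity: diagonal points are directions and sides are lines with prescribed
    directions. *)
Let l y : K := det3 A B y.

Let lZ k y : l (k *: y) = k * l y. Proof. by rewrite /l; det_ring. Qed.
Let lD y z : l (y + z) = l y + l z. Proof. by rewrite /l; det_ring. Qed.

Let l_cross y z : l y != 0 -> l z = 0 -> z != 0 -> cross y z != 0.
Proof.
move=> hy hz z0; apply/eqP => /(parallel z0)[k e].
by move: hy; rewrite e lZ hz mulr0 eqxx.
Qed.

Let l_chord (a b c : 'rV[K]_3) : l a = 1 -> l b = 1 -> l c = 0 -> c != 0 -> det3 a b c = 0 ->
  exists m, b = a + m *: c.
Proof.
move=> la lb lc c0 dabc; have [||k [m e]] := @span2 _ a c b.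
- by apply: l_cross; rewrite // la oner_eq0.
- by rewrite det3_swapr dabc oppr0.
- by exists m; move: lb; rewrite e lD !lZ la lc mulr0 addr0 mulr1 => ->; rewrite scale1r.
Qed.

(** In the chart [l = 1], lines with distinct directions meet: [b - a] lies in the direction plane,
    which [c] and [c'] span. *)
Let l_meet (a b c c' : 'rV[K]_3) : cross A B != 0 -> l a = 1 -> l b = 1 -> l c = 0 -> l c' = 0 ->
  cross c c' != 0 -> exists y m m', y = a + m *: c /\ b = y + m' *: c'.
Proof.
move=> AB la lb lc lc' cc'.
have [k1 [l1 e1]] := span2 AB lc; have [k2 [l2 e2]] := span2 AB lc'.
have lba : l (b - a) = 0 by rewrite -scaleN1r lD lZ la lb mulr1 subrr.
have [||m [m' e]] := @span2 _ c c' (b - a) => //.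
  have [k3 [l3 ->]] := span2 AB lba; rewrite e1 e2.
  by det_ring.
by exists (a + m *: c), m, m'; split=> //; rewrite -addrA -e addrC subrK.
Qed.

(* A closed polygon whose sides have the prescribed directions c i in the plane
   l = 0 and which passes through the given points off that plane. *)
Lemma lift_polygon x c m : cross A B != 0 ->
  (forall i, c i != 0) -> (forall i, l (c i) = 0) ->
  (forall i, cross (c i) (c i.+1) != 0) ->
  (forall i, (i < m)%N -> det3 (x i) (x i.+1) (c i) = 0) ->
  l (x 0%N) != 0 -> l (x m) != 0 ->
  exists n, [/\ forall i, (i <= m)%N -> l (n i) = 1,
    forall i, (i <= m)%N -> l (x i) != 0 -> x i = l (x i) *: n i
    & forall i, (i < m)%N -> exists k, n i.+1 = n i + k *: c i].
Proof.
move=> AB c0 lc cc edge x0 xm.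
pose nrm i := (l (x i))^-1 *: x i.
have lnrm i : l (x i) != 0 -> l (nrm i) = 1 by move=> h; rewrite lZ mulVf.
have nrmK i : l (x i) != 0 -> x i = l (x i) *: nrm i.
  by move=> h; rewrite scalerA mulfV ?scale1r.
have chord i : (i < m)%N -> l (x i) != 0 -> l (x i.+1) != 0 ->
    exists k, nrm i.+1 = nrm i + k *: c i.
  move=> im hi hi1; apply: l_chord => //; try exact: lnrm.
  have -> : det3 (nrm i) (nrm i.+1) (c i)
    = (l (x i))^-1 * (l (x i.+1))^-1 * det3 (x i) (x i.+1) (c i).
    by rewrite /nrm; move: (_^-1) (_^-1) => u v; det_ring.
  by rewrite edge // mulr0.
(* The fourth clause looks one vertex ahead: a vertex in the plane is free to choose, but the next
   one, if it is off the plane, has to remain reachable along [c v]. *)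
suff H v : (v <= m)%N -> exists n, [/\ forall i, (i <= v)%N -> l (n i) = 1,
    forall i, (i <= v)%N -> l (x i) != 0 -> x i = l (x i) *: n i,
    forall i, (i < v)%N -> exists k, n i.+1 = n i + k *: c i
    & (v < m)%N -> l (x v.+1) != 0 -> exists k, nrm v.+1 = n v + k *: c v].
  by have [n [h1 h2 h3 _]] := H m (leqnn m); exists n.
elim: v => [|v IH] vm.
  exists (fun=> nrm 0%N); split=> // [i _|i|v0 h].
  - exact: lnrm.
  - by rewrite leqn0 => /eqP-> _; apply: nrmK.
  - exact: chord.
have [n [h1 h2 h3 h4]] := IH (ltnW vm).
suff [y [ly yx [k yk] ynext]] : exists y, [/\ l y = 1,
    l (x v.+1) != 0 -> x v.+1 = l (x v.+1) *: y,
    exists k, y = n v + k *: c v &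
    (v.+1 < m)%N -> l (x v.+2) != 0 -> exists k, nrm v.+2 = y + k *: c v.+1].
  exists (fun i => if (i <= v)%N then n i else y); split=> [i|i|i|].
  - by case: ifP => // h _; apply: h1.
  - case: ifP => [h _|h iv]; first exact: h2.
    suff -> : i = v.+1 by [].
    by apply/eqP; rewrite eqn_leq iv ltnNge h.
  - rewrite ltnS => iv; rewrite iv; case: ifP => h; first exact: h3.
    have -> : i = v by apply/eqP; rewrite eqn_leq iv leqNgt h.
    by exists k.
  - by rewrite ltnn; apply: ynext.
(* A vertex off the plane is forced. One in the plane followed by one off it is the intersection of
   two lines. Otherwise the polygon stays at [n v], with a side of length zero. *)
have [e|e] := eqVneq (l (x v.+1)) 0; last first.
  exists (nrm v.+1); split=> // [|_||vm' h]; first exact: lnrm.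
  - exact: nrmK.
  - exact: h4.
  - exact: chord.
have [/andP[vm' h]|h] := boolP ((v.+1 < m)%N && (l (x v.+2) != 0)).
  have [y [k [k' [ey ey']]]] := l_meet AB (h1 v (leqnn v)) (lnrm _ h) (lc v) (lc v.+1) (cc v).
  exists y; split=> [||| _ _] //; [|by exists k|by exists k'].
  by rewrite ey lD lZ lc mulr0 addr0 h1.
exists (n v); split=> [|||vm' h']; [exact: h1|by []| |].
  by exists 0; rewrite scale0r addr0.
by rewrite vm' h' in h.
Qed.

(** The equations form a path, so a nonzero solution extends from [m] to [m.+1] by division by
    [p m], or by zero when [m.+1] is outside [S]. If [m.+1] is in [S] and either [m] is outside [S]
    or [p m = 0], the vector supported at [m.+1] alone is a solution. *)
Lemma heights (S : nat -> bool) p q m : (exists2 i, (i <= m)%N & S i) ->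
  exists h, [/\ forall i, (i <= m)%N -> ~~ S i -> h i = 0,
    exists2 i, (i <= m)%N & h i != 0
    & forall i, (i < m)%N -> S i -> S i.+1 -> h i * q i = h i.+1 * p i].
Proof.
elim: m => [|m IH] [i im Si].
  move: im Si; rewrite leqn0 => /eqP-> S0; exists (fun=> 1); split=> // [i'|].
    by rewrite leqn0 => /eqP->; rewrite S0.
  by exists 0%N; rewrite ?oner_eq0.
have extend e : (exists2 i, (i <= m)%N & S i) ->
    (~~ S m.+1 -> forall h, e h = 0) ->
    (S m -> S m.+1 -> forall h, h m * q m = e h * p m) ->
    exists h, [/\ forall i, (i <= m.+1)%N -> ~~ S i -> h i = 0,
      exists2 i, (i <= m.+1)%N & h i != 0
      & forall i, (i < m.+1)%N -> S i -> S i.+1 -> h i * q i = h i.+1 * p i].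
  move=> /IH[h [h1 [k km hk] h3]] e0 em.
  exists (fun i => if (i <= m)%N then h i else e h); split.
  - move=> j jm Sj; case: ifP => jm'; first exact: h1.
    suff je : j = m.+1 by rewrite je in Sj; apply: e0.
    by apply/eqP; rewrite eqn_leq jm ltnNge jm'.
  - by exists k; rewrite ?km // leqW.
  - move=> j; rewrite ltnS => jm; rewrite jm; case: ifP => jm'; first exact: h3.
    suff -> : j = m by move=> Sm Sm1; apply: em.
    by apply/eqP; rewrite eqn_leq jm leqNgt jm'.
have [Sm1|Sm1] := boolP (S m.+1); last first.
  apply: (extend (fun=> 0)) => //; last by rewrite (negPf Sm1).
  exists i => //; move: im; rewrite leq_eqVlt => /orP[/eqP e|//].
  by rewrite -e Si in Sm1.
have [/andP[Sm pm]|Sp] := boolP (S m && (p m != 0)).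
  apply: (extend (fun h => h m * q m / p m)); first by exists m.
    by rewrite Sm1.
  by move=> _ _ h; rewrite divfK.
exists (fun j => (j == m.+1)%:R); split.
- by move=> j _; case: eqP => // ->; rewrite Sm1.
- by exists m.+1; rewrite ?eqxx ?oner_eq0.
- move=> j jm Sj _; rewrite (ltn_eqF jm) mul0r eqSS; case: eqP => [e|]; last by rewrite mul0r.
  by move: Sp; rewrite -e Sj negbK => /eqP->; rewrite mulr0.
Qed.

(* The points of a hexagon lying in the plane l = 0 can be moved off it: the
   sides keep meeting their diagonal points when the points move towards the
   vertices of a lifted polygon with speeds solving a linear system. *)
Lemma hexagon_direction x c : cross A B != 0 ->
  (forall i, c i != 0) -> (forall i, l (c i) = 0) ->
  (forall i, cross (c i) (c i.+1) != 0) ->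
  (forall i, (i < 6)%N -> det3 (x i) (x i.+1) (c i) = 0) ->
  x 6%N = x 0%N -> l (x 0%N) != 0 -> (exists2 i, (i < 6)%N & l (x i) = 0) ->
  exists d, [/\ d 6%N = d 0%N,
    forall i t, (i < 6)%N ->
      det3 (x i + t *: d i) (x i.+1 + t *: d i.+1) (c i) = 0,
    forall i, (i < 6)%N -> l (x i) != 0 -> d i = 0
    & exists2 i, (i < 6)%N & l (d i) != 0].
Proof.
move=> AB c0 lc cc edge x6 x0 [j j6 xj].
have x6n : l (x 6%N) != 0 by rewrite x6.
have [n [ln nx nc]] := lift_polygon AB c0 lc cc edge x0 x6n.
have [|h [h1 [k k6 hk] h3]] := @heights (fun i => l (x i) == 0)
  (fun i => det3 (n i) (x i) (c i)) (fun i => det3 (n i) (x i.+1) (c i)) 6.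
  by exists j; [apply: ltnW|rewrite xj].
(* Vertex 0, which is also vertex 6, is off the plane, so both ends of the path get height zero and
   the solution closes up to the cycle. *)
have h0 : h 0%N = 0 by apply: h1.
have h6 : h 6%N = 0 by apply: h1.
exists (fun i => h i *: n i); split.
- by rewrite h0 h6 !scale0r.
- move=> i t i6; have [m e] := nc i i6.
  (* There is no term in the square of [t], since [n i.+1 - n i] is a multiple of [c i]. *)
  have -> : det3 (x i + t *: (h i *: n i)) (x i.+1 + t *: (h i.+1 *: n i.+1)) (c i)
    = det3 (x i) (x i.+1) (c i)
      + t * (h i * det3 (n i) (x i.+1) (c i) - h i.+1 * det3 (n i) (x i) (c i)).
    by rewrite e; move: (h i) (h i.+1) => u v; det_ring.
  rewrite edge // add0r.
  (* Between two vertices in the plane the linear term is the equation solved by [h]. A vertex off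
     the plane has height zero and is a multiple of its lift, which makes the remaining determinant
     vanish. *)
  have [xi|xi] := eqVneq (l (x i)) 0; have [xi1|xi1] := eqVneq (l (x i.+1)) 0.
  + by rewrite h3 ?xi ?xi1 // subrr mulr0.
  + rewrite (h1 i.+1) // mul0r subr0 (nx i.+1) // e.
    by move: (h i) (l _) => u v; det_ring.
  + rewrite (h1 i) 1?ltnW // mul0r sub0r (nx i) 1?ltnW //.
    by move: (h i.+1) (l _) => u v; det_ring.
  + by rewrite (h1 i) 1?ltnW // (h1 i.+1) // !mul0r subr0 mulr0.
- by move=> i i6 xi; rewrite h1 ?scale0r // ltnW.
- exists k; last by rewrite lZ ln // mulr1.
  by move: k6; rewrite leq_eqVlt => /orP[/eqP e|//]; rewrite e h6 eqxx in hk.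
Qed.

End DistinctDiagonalPoints.

Section Hexagon.
Variable K : numFieldType.
Implicit Types (A B C x y z b u v d r : 'rV[K]_3).

(* In the Pascal configuration the hexagon is 1, 6, 2, 4, 3, 5 and its sides
   pass in turn through 8, 9, 7, 8, 9, 7. *)
Definition hexagon x0 x1 x2 x3 x4 x5 A B C : Prop :=
  [/\ det3 A B C = 0, det3 x0 x1 A = 0, det3 x1 x2 B = 0, det3 x2 x3 C = 0 &
  [/\ det3 x3 x4 A = 0, det3 x4 x5 B = 0 & det3 x5 x0 C = 0]].

Lemma hexagon_rot x0 x1 x2 x3 x4 x5 A B C :
  hexagon x0 x1 x2 x3 x4 x5 A B C -> hexagon x1 x2 x3 x4 x5 x0 B C A.
Proof.
move=> [h h0 h1 h2 [h3 h4 h5]]; split=> //.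
by rewrite -h; det_ring.
Qed.

(** Inverse to the shift of [hexagon_rot]: it sends [[:: x1; x2; x3; x4; x5; x0; B; C; A]] back to
    [[:: x0; x1; x2; x3; x4; x5; A; B; C]]. *)
Definition rot_hexagon (s : seq 'rV[K]_3) : seq 'rV[K]_3 :=
  [seq nth 0 s i | i <- [:: 5; 0; 1; 2; 3; 4; 8; 6; 7]%N].

Lemma curve_closed_rot Q :
  curve_closed Q -> curve_closed (fun s => Q (rot_hexagon s)).
Proof. exact: curve_closed_reindex. Qed.

Lemma planar_rot x0 x1 x2 x3 x4 x5 A B C :
  planar [:: x1; x2; x3; x4; x5; x0; B; C; A] ->
  planar [:: x0; x1; x2; x3; x4; x5; A; B; C].
Proof.
move=> [a [b h]]; exists a, b; case=> [|[|[|[|[|[|[|[|[|i]]]]]]]]].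
- exact: (h 5%N). - exact: (h 0%N). - exact: (h 1%N). - exact: (h 2%N).
- exact: (h 3%N). - exact: (h 4%N). - exact: (h 8%N). - exact: (h 6%N).
- exact: (h 7%N).
by exists 0, 0; rewrite /= nth_nil !scale0r addr0.
Qed.

Definition generic_hexagon x0 x1 x2 x3 x4 x5 A B C : Prop :=
  [/\ hexagon x0 x1 x2 x3 x4 x5 A B C,
    cross A B != 0, cross B C != 0, cross C A != 0 &
    all (fun x => det3 A B x != 0) [:: x0; x1; x2; x3; x4; x5]].

(** The two situations where the perturbations stop: generic hexagons are reached by the
    parametrization for M, planar ones have rank at most two. *)
Definition contains_hexagons (Q : seq 'rV[K]_3 -> Prop) : Prop :=
  forall x0 x1 x2 x3 x4 x5 A B C,
    generic_hexagon x0 x1 x2 x3 x4 x5 A B C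
    \/ planar [:: x0; x1; x2; x3; x4; x5; A; B; C]
       /\ hexagon x0 x1 x2 x3 x4 x5 A B C ->
    Q [:: x0; x1; x2; x3; x4; x5; A; B; C].

(** [C] is a combination of [A] and [B] with nonzero coefficient at [A], so the two forms are
    proportional. Hence being off the plane is invariant under rotation. *)
Lemma det3_plane A B C x : det3 A B C = 0 -> cross A B != 0 -> cross B C != 0 ->
  (det3 B C x == 0) = (det3 A B x == 0).
Proof.
move=> d AB BC; have [k [l e]] := span2 AB d.
have k0 : k != 0.
  apply: contraNneq BC => k0; rewrite e k0 scale0r add0r.
  have -> : cross B (l *: B) = l *: cross B B by vec_ring.
  by rewrite crossxx scaler0.
have -> : det3 B C x = - k * det3 A B x by rewrite e; det_ring.
by rewrite mulf_eq0 oppr_eq0 (negPf k0).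
Qed.

Lemma contains_hexagons_rot Q : contains_hexagons Q ->
  contains_hexagons (fun s => Q (rot_hexagon s)).
Proof.
move=> H x1 x2 x3 x4 x5 x0 B C A hyp; apply: (H x0 x1 x2 x3 x4 x5 A B C).
case: hyp => [[hx BC CA AB /and5P[h1 h2 h3 h4 /and3P[h5 h0 _]]]|[pl hx]]; last first.
  (* The rotation has order six, so five more turns undo it. *)
  by right; split; [apply: planar_rot | do 5!apply: hexagon_rot].
left; have hx' : hexagon x0 x1 x2 x3 x4 x5 A B C by do 5!apply: hexagon_rot.
case: (hx') => dABC _ _ _ _; split=> //=; move: h0 h1 h2 h3 h4 h5.
by rewrite !(det3_plane _ dABC AB BC) => -> -> -> -> -> ->.
Qed.

(** Induction on a bound for the number of vertices in the plane. Along the direction of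
    [hexagon_direction], for every nonzero [t], vertices off the plane do not move and at least one
    more leaves it. *)
Lemma hexagon_one_off Q A B C : curve_closed Q -> contains_hexagons Q ->
  cross A B != 0 -> cross B C != 0 -> cross C A != 0 -> det3 A B C = 0 ->
  forall m (x : nat -> 'rV[K]_3),
  (#|[set i : 'I_6 | det3 A B (x i) == 0%R]| <= m)%N ->
  (forall i, (i < 6)%N ->
     det3 (x i) (x i.+1) (nth 0 [:: A; B; C; A; B; C] i) = 0) ->
  x 6%N = x 0%N -> det3 A B (x 0%N) != 0 -> Q (mkseq x 6 ++ [:: A; B; C]).
Proof.
move=> Qc H AB BC CA dABC.
have A0 : A != 0 by apply: contraNneq AB => ->; rewrite cross0v.
have B0 : B != 0 by apply: contraNneq AB => ->; rewrite crossv0.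
have C0 : C != 0 by apply: contraNneq CA => ->; rewrite cross0v.
(* The period-three extension makes the hypotheses on [c] in [hexagon_direction] hold for all
   indices. *)
pose c i := nth 0 [:: A; B; C] (i %% 3).
have cE i : [\/ c i = A /\ c i.+1 = B, c i = B /\ c i.+1 = C | c i = C /\ c i.+1 = A].
  rewrite /c -(addn1 i) -(modnDml i 1); have := ltn_pmod i (isT : (0 < 3)%N).
  by case: (i %% 3)%N => [|[|[|//]]] _; [constructor 1|constructor 2|constructor 3].
have dA : det3 A B A = 0 by det_ring.
have dB : det3 A B B = 0 by det_ring.
have c0 i : c i != 0 by case: (cE i) => -[-> _].
have lc i : det3 A B (c i) = 0 by case: (cE i) => -[-> _].
have cc i : cross (c i) (c i.+1) != 0 by case: (cE i) => -[-> ->].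
have ci i : (i < 6)%N -> nth 0 [:: A; B; C; A; B; C] i = c i.
  by case: i => [|[|[|[|[|[|]]]]]].
elim=> [|m IH] x cx edge x6 x0;
    have [[j j6 xj]|off] := pselect (exists2 i, (i < 6)%N & det3 A B (x i) = 0).
- move: cx; rewrite leqn0 cards_eq0 => /eqP/setP/(_ (Ordinal j6)).
  by rewrite !inE /= xj eqxx.
- apply: H; left; have e i : (i < 6)%N -> det3 A B (x i) != 0.
    by move=> i6; apply/eqP => h; apply: off; exists i.
  split=> //; last by rewrite /= !e.
  have h i (i6 : (i < 6)%N) := edge i i6.
  by split; rewrite ?(h 0%N, h 1%N, h 2%N, h 3%N, h 4%N) // -x6 (h 5%N).
- have [||d [d6 dedge d0 [k k6 dk]]] := @hexagon_direction _ A B x c AB c0 lc cc _ x6 x0.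
  + by move=> i i6; rewrite -ci ?edge.
  + by exists j.
  apply: (Qc (mkseq (fun i t => x i + t *: d i) 6 ++ [:: fun=> A; fun=> B; fun=> C])).
  + by do 9!(split; first by poly_fun).
  + by rewrite /= !scale0r !addr0.
  move=> t t0; apply: (IH (fun i => x i + t *: d i)).
  + rewrite -ltnS; apply: leq_trans cx; apply: proper_card; apply/properP; split.
      apply/fintype.subsetP=> i; rewrite !inE; apply: contraLR => xi.
      by rewrite d0 ?scaler0 ?addr0.
    exists (Ordinal k6); rewrite !inE /=.
      by apply: contraNT dk => xk; rewrite d0 //; apply/eqP; det_ring.
    have -> : det3 A B (x k + t *: d k) = det3 A B (x k) + t * det3 A B (d k) by det_ring.
    have [->|xk] := eqVneq (det3 A B (x k)) 0; first by rewrite add0r mulf_neq0.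
    by move: dk; rewrite d0 //; case/eqP; det_ring.
  + by move=> i i6; rewrite ci // dedge.
  + by rewrite x6 d6.
  + by rewrite d0 // scaler0 addr0.
- apply: H; left; have e i : (i < 6)%N -> det3 A B (x i) != 0.
    by move=> i6; apply/eqP => h; apply: off; exists i.
  split=> //; last by rewrite /= !e.
  have h i (i6 : (i < 6)%N) := edge i i6.
  by split; rewrite ?(h 0%N, h 1%N, h 2%N, h 3%N, h 4%N) // -x6 (h 5%N).
Qed.

(** A rotation brings a vertex off the plane to position 0, where the cycle is cut. If there is
    none, all nine vectors lie in the plane of [A] and [B]. *)
Lemma hexagon_distinct Q A B C x0 x1 x2 x3 x4 x5 :
  curve_closed Q -> contains_hexagons Q ->
  cross A B != 0 -> cross B C != 0 -> cross C A != 0 ->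
  hexagon x0 x1 x2 x3 x4 x5 A B C -> Q [:: x0; x1; x2; x3; x4; x5; A; B; C].
Proof.
have base Q' A' B' C' y0 y1 y2 y3 y4 y5 : curve_closed Q' -> contains_hexagons Q' ->
    cross A' B' != 0 -> cross B' C' != 0 -> cross C' A' != 0 ->
    hexagon y0 y1 y2 y3 y4 y5 A' B' C' -> det3 A' B' y0 != 0 ->
    Q' [:: y0; y1; y2; y3; y4; y5; A'; B'; C'].
  move=> Qc H AB BC CA [d h0 h1 h2 [h3 h4 h5]] y0n.
  apply: (hexagon_one_off Qc H AB BC CA d (m := 6%N)
    (x := nth 0 [:: y0; y1; y2; y3; y4; y5; y0])) => //.
    by rewrite (leq_trans (max_card _)) ?card_ord.
  by case=> [|[|[|[|[|[|]]]]]].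
move=> Qc H AB BC CA hx; have [dABC _ _ _ _] := hx.
have [e0|n] := eqVneq (det3 A B x0) 0; last exact: base.
have hx1 := hexagon_rot hx; have hx2 := hexagon_rot hx1.
have hx3 := hexagon_rot hx2; have hx4 := hexagon_rot hx3; have hx5 := hexagon_rot hx4.
have Qc1 := curve_closed_rot Qc; have H1 := contains_hexagons_rot H.
have Qc2 := curve_closed_rot Qc1; have H2 := contains_hexagons_rot H1.
have Qc3 := curve_closed_rot Qc2; have H3 := contains_hexagons_rot H2.
have Qc4 := curve_closed_rot Qc3; have H4 := contains_hexagons_rot H3.
have Qc5 := curve_closed_rot Qc4; have H5 := contains_hexagons_rot H4.
have BCE := det3_plane _ dABC AB BC.
have CAE x : (det3 C A x == 0) = (det3 A B x == 0).
  by rewrite -BCE (@det3_plane B C A) // -dABC; det_ring.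
have [e1|n] := eqVneq (det3 A B x1) 0; last
  by apply: (base _ _ _ _ _ _ _ _ _ _ Qc1 H1) => //; rewrite BCE.
have [e2|n] := eqVneq (det3 A B x2) 0; last
  by apply: (base _ _ _ _ _ _ _ _ _ _ Qc2 H2) => //; rewrite CAE.
have [e3|n] := eqVneq (det3 A B x3) 0; last
  by apply: (base _ _ _ _ _ _ _ _ _ _ Qc3 H3).
have [e4|n] := eqVneq (det3 A B x4) 0; last
  by apply: (base _ _ _ _ _ _ _ _ _ _ Qc4 H4) => //; rewrite BCE.
have [e5|n] := eqVneq (det3 A B x5) 0; last
  by apply: (base _ _ _ _ _ _ _ _ _ _ Qc5 H5) => //; rewrite CAE.
apply: H; right; split=> //; exists A, B.
do 9?[apply: spanned_cons => //]; try by det_ring.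
exact: spanned_nil.
Qed.
End Hexagon.

(** * Hexagons with parallel diagonal points *)

Section ParallelDiagonalPoints.
Variable K : numFieldType.
Implicit Types (A B C x y z b u v d r : 'rV[K]_3) (k l m : K).

(* Moving the diagonal point C of the side u v, when u is itself on the line of
   C: the point u follows alone, either along C or as the intersection of the
   sides b u and u v. *)
Lemma move_on_diagonal A C k b u v r : A != 0 -> k != 0 -> C = k *: A ->
  cross u A = 0 -> cross b A = 0 \/ det3 b v A != 0 ->
  exists u' : K -> 'rV[K]_3, [/\ curve u', u' 0 = u
    & forall t, det3 b (u' t) A = 0 /\ det3 (u' t) v (C + t *: r) = 0].
Proof.
move=> A0 k0 eC uA h; have [al e] := parallel A0 uA.
case: h => [bA|n].
  have [be eb] := parallel A0 bA.
  exists (fun t => (al / k) *: (C + t *: r)); split.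
  - by poly_fun.
  - by rewrite scale0r addr0 eC scalerA divfK // e.
  - move=> t; split; last by move: (al / k) => q; det_ring.
    by rewrite eb; det_ring.
pose q := al / (k * det3 b v A).
exists (fun t => q *: cross (cross b A) (cross v (C + t *: r))); split.
- by poly_fun.
- rewrite scale0r addr0 cross_cross eC e.
  have -> : det3 b A (k *: A) *: v - det3 b A v *: (k *: A) = (k * det3 b v A) *: A.
    by vec_ring.
  by rewrite scalerA divfK // mulf_neq0.
- by move=> t; move: q => q; split; det_ring.
Qed.

Lemma side_span A u v : cross u A != 0 -> det3 u v A = 0 ->
  exists k l, v = k *: u + l *: A.
Proof. by move=> uA h; apply: span2; rewrite // det3_swapr h oppr0. Qed.

(* The side u v with diagonal point C follows C; its neighbours b and d stay. *)
Lemma move_side_two A B C k b u v d : A != 0 -> k != 0 -> C = k *: A ->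
  cross A B != 0 ->
  det3 b u A = 0 -> det3 u v C = 0 -> det3 v d B = 0 ->
  [\/ cross u A != 0, cross b A = 0 | det3 b v A != 0] ->
  exists u' v' : K -> 'rV[K]_3, [/\ curve u', curve v', u' 0 = u, v' 0 = v
    & forall t, [/\ det3 b (u' t) A = 0, det3 (u' t) (v' t) (C + t *: B) = 0
                  & det3 (v' t) d B = 0]].
Proof.
move=> A0 k0 eC AB hb huv hd h.
have [uA|uA] := eqVneq (cross u A) 0.
  have h' : cross b A = 0 \/ det3 b v A != 0.
    by case: h => [|h|h]; [rewrite uA eqxx|left|right].
  have [u' [cu u0 hu]] := move_on_diagonal B A0 k0 eC uA h'.
  exists u', (fun=> v); split=> //; first by poly_fun.
  by move=> t; have [h1 h2] := hu t.
have uC : cross u C != 0.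
  have -> : cross u C = k *: cross u A by rewrite eC; vec_ring.
  by rewrite scaler_eq0 negb_or k0.
have [x [y ev]] := side_span uC huv.
have [dB|dB] := eqVneq (cross d B) 0.
  exists (fun=> u), (fun t => x *: u + y *: (C + t *: B)); split; first by poly_fun.
  - by poly_fun.
  - by [].
  - by rewrite scale0r addr0 ev.
  - move=> t; split=> //; first by det_ring.
    have B0 : B != 0 by apply: contraNneq AB => ->; rewrite crossv0.
    by have [m ->] := parallel B0 dB; det_ring.
have [w0|w0] := eqVneq (cross (cross u C) (cross d B)) 0; last first.
  have [||q eq] := @meetP _ u C d B v _ _ w0.
  - by rewrite det3_swapr huv oppr0.
  - by rewrite -hd; det_ring.
  exists (fun=> u), (fun t => q *: cross (cross u (C + t *: B)) (cross d B)); split.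
  - by poly_fun.
  - by poly_fun.
  - by [].
  - by rewrite scale0r addr0 eq.
  - by move=> t; split=> //; det_ring.
(* The planes [u C] and [d B] coincide, so the side already contains [C + t *: B] and nothing has to
   move. *)
exists (fun=> u), (fun=> v); split=> //; try by poly_fun.
move=> t; split=> //.
have uCB : det3 u C B = 0.
  apply: contraNeq dB => n; move: w0; rewrite cross_cross => /eqP.
  rewrite subr_eq0 => /eqP/(congr1 (fun z => (det3 u C B)^-1 *: z)).
  rewrite !scalerA mulVf // scale1r => ->; move: (_ * _) => m.
  by apply/eqP; vec_ring.
have -> : det3 u v (C + t *: B) = det3 u v C + t * y * det3 u C B by rewrite ev; det_ring.
by rewrite huv uCB mulr0 addr0.
Qed.

(** An end on the line of [A] follows as in [move_on_diagonal]; an end whose neighbour is on that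
    line is free to follow. If none of the four is on it, the side stays, and [r] has to be chosen
    in its plane: this is the last hypothesis. *)
Lemma move_side_three A B C k m b u v d r : A != 0 -> k != 0 -> C = k *: A ->
  B = m *: A ->
  det3 b u A = 0 -> det3 u v C = 0 -> det3 v d B = 0 -> m != 0 ->
  [\/ cross u A != 0, cross b A = 0 | det3 b v A != 0] ->
  [\/ cross v A != 0, cross d A = 0 | det3 d u A != 0] ->
  (cross b A != 0 -> cross d A != 0 -> cross u A != 0 -> cross v A != 0 ->
    det3 u A r = 0) ->
  exists u' v' : K -> 'rV[K]_3, [/\ curve u', curve v', u' 0 = u, v' 0 = v
    & forall t, [/\ det3 b (u' t) A = 0, det3 (u' t) (v' t) (C + t *: r) = 0
                  & det3 (v' t) d B = 0]].
Proof.
move=> A0 k0 eC eB hb huv hd m0 hu hv stuck.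
have [uA|uA] := eqVneq (cross u A) 0.
  have h' : cross b A = 0 \/ det3 b v A != 0.
    by case: hu => [|h|h]; [rewrite uA eqxx|left|right].
  have [u' [cu u0 hu']] := move_on_diagonal r A0 k0 eC uA h'.
  exists u', (fun=> v); split=> //; first by poly_fun.
  by move=> t; have [h1 h2] := hu' t.
have [vA|vA] := eqVneq (cross v A) 0.
  have h' : cross d A = 0 \/ det3 d u A != 0.
    by case: hv => [|h|h]; [rewrite vA eqxx|left|right].
  have [v' [cv v0 hv']] := move_on_diagonal r A0 k0 eC vA h'.
  exists (fun=> u), v'; split=> //; first by poly_fun.
  move=> t; have [h1 h2] := hv' t; split=> //.
    by rewrite det3_swapl h2 oppr0.
  have -> : det3 (v' t) d B = - m * det3 d (v' t) A by rewrite eB; det_ring.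
  by rewrite h1 mulr0.
have along w w' : cross w A != 0 -> det3 w w' C = 0 ->
    exists k l, w' = k *: w + l *: C.
  move=> wA; apply: side_span.
  have -> : cross w C = k *: cross w A by rewrite eC; vec_ring.
  by rewrite scaler_eq0 negb_or k0.
have [dA|dA] := eqVneq (cross d A) 0.
  have [x [y ev]] := along _ _ uA huv.
  exists (fun=> u), (fun t => x *: u + y *: (C + t *: r)); split.
  - by poly_fun.
  - by poly_fun.
  - by [].
  - by rewrite scale0r addr0 ev.
  - move=> t; split=> //; first by det_ring.
    by have [q ->] := parallel A0 dA; rewrite eB; det_ring.
have [bA|bA] := eqVneq (cross b A) 0.
  have [x [y eu]] : exists k l, u = k *: v + l *: C.
    by apply: along; rewrite // det3_swapl huv oppr0.
  exists (fun t => x *: v + y *: (C + t *: r)), (fun=> v); split.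
  - by poly_fun.
  - by poly_fun.
  - by rewrite scale0r addr0 eu.
  - by [].
  - move=> t; split=> //; last by det_ring.
    by have [q ->] := parallel A0 bA; det_ring.
exists (fun=> u), (fun=> v); split=> //; try by poly_fun.
move=> t; split=> //; have [x [y ev]] := along _ _ uA huv.
have -> : det3 u v (C + t *: r) = det3 u v C + t * y * k * det3 u A r.
  by rewrite ev eC; det_ring.
by rewrite huv stuck // mulr0 addr0.
Qed.

(** In the excluded case [u] is confined to the plane of [b] and [A], which contains [v]: with [v]
    fixed and independent of the moved [u], the side cannot pass through a diagonal point outside
    this plane. *)
Definition movable A b u v : Prop :=
  [\/ cross u A != 0, cross b A = 0 | det3 b v A != 0].

Lemma movableP A b u v :
  movable A b u v \/ [/\ cross u A = 0, cross b A != 0 & det3 b v A = 0].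
Proof.
have [h1|] := eqVneq (cross u A) 0; last by left; constructor 1.
have [|h2] := eqVneq (cross b A) 0; first by left; constructor 2.
have [h3|] := eqVneq (det3 b v A) 0; last by left; constructor 3.
by right.
Qed.

(** A blocked [u] is pushed towards [b]. The side [b u] is unchanged, and the side [u v] keeps its
    diagonal point since [v] lies in the plane of [b] and [A]. *)
Lemma movable_perturb A b u v t :
  t != 0 -> cross u A = 0 -> cross b A != 0 -> movable A b (u + t *: b) v.
Proof.
move=> t0 h1 h2; constructor 1.
have -> : cross (u + t *: b) A = cross u A + t *: cross b A by vec_ring.
by rewrite h1 add0r scaler_eq0 negb_or t0.
Qed.

Lemma det3_swap0 x y z : det3 x y z = 0 -> det3 y x z = 0.
Proof. by move=> h; rewrite det3_swapl h oppr0. Qed.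

Lemma det3_perturb x y z b t : det3 x y z = 0 -> det3 b y z = 0 ->
  det3 (x + t *: b) y z = 0.
Proof.
move=> h1 h2; have -> : det3 (x + t *: b) y z = det3 x y z + t * det3 b y z by det_ring.
by rewrite h1 h2 mulr0 addr0.
Qed.

Lemma det3_scale0 k x y A C : C = k *: A -> det3 x y A = 0 -> det3 x y C = 0.
Proof.
move=> -> h; have -> : det3 x y (k *: A) = k * det3 x y A by det_ring.
by rewrite h mulr0.
Qed.

Ltac solve_curves := rewrite /=; do 9!(split; first by poly_fun).

(** The sides through [C] are [x2 x3] and [x5 x0]. They share no vertex and are separated by [x1]
    and [x4], so with these and [A], [B] fixed each follows [C + t *: B] independently, and
    [hexagon_distinct] applies for nonzero [t]. *)
Lemma hexagon_two Q A B C k x0 x1 x2 x3 x4 x5 :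
  curve_closed Q -> contains_hexagons Q ->
  A != 0 -> k != 0 -> C = k *: A -> cross A B != 0 ->
  hexagon x0 x1 x2 x3 x4 x5 A B C -> Q [:: x0; x1; x2; x3; x4; x5; A; B; C].
Proof.
move=> Qc H A0 k0 eC AB.
have both y0 y1 y2 y3 y4 y5 : hexagon y0 y1 y2 y3 y4 y5 A B C ->
    movable A y4 y3 y2 -> movable A y1 y0 y5 -> Q [:: y0; y1; y2; y3; y4; y5; A; B; C].
  move=> [_ h0 h1 h2 [h3 h4 h5]] m1 m2.
  have [u3 [v2 [cu3 cv2 e3 e2 hm1]]] := move_side_two A0 k0 eC AB
    (det3_swap0 h3) (det3_swap0 h2) (det3_swap0 h1) m1.
  have [u0 [v5 [cu0 cv5 e0 e5 hm2]]] := move_side_two A0 k0 eC AB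
    (det3_swap0 h0) (det3_swap0 h5) (det3_swap0 h4) m2.
  apply: (Qc [:: u0; fun=> y1; v2; u3; fun=> y4; v5; fun=> A; fun=> B;
                 fun t => C + t *: B]).
  - by solve_curves.
  - by rewrite /= e0 e2 e3 e5 scale0r addr0.
  move=> t t0; have [a1 a2 a3] := hm1 t; have [b1 b2 b3] := hm2 t.
  have BA : cross B A != 0 by rewrite crossC oppr_eq0.
  apply: hexagon_distinct => //.
  - have -> : cross B (C + t *: B) = k *: cross B A by rewrite eC; vec_ring.
    by rewrite scaler_eq0 negb_or k0.
  - have -> : cross (C + t *: B) A = t *: cross B A by rewrite eC; vec_ring.
    by rewrite scaler_eq0 negb_or t0.
  - split; [by rewrite eC; det_ring|exact: det3_swap0|exact: det3_swap0
           |exact: det3_swap0|split; exact: det3_swap0].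
have one y0 y1 y2 y3 y4 y5 : hexagon y0 y1 y2 y3 y4 y5 A B C ->
    movable A y1 y0 y5 -> Q [:: y0; y1; y2; y3; y4; y5; A; B; C].
  move=> hx m2; have [m1|[u0 b0 d]] := movableP A y4 y3 y2; first exact: both.
  apply: (Qc [:: fun=> y0; fun=> y1; fun=> y2; fun t => y3 + t *: y4; fun=> y4;
                 fun=> y5; fun=> A; fun=> B; fun=> C]).
  - by solve_curves.
  - by rewrite /= scale0r addr0.
  move=> t t0; apply: both => //; last exact: movable_perturb.
  case: hx => hd h0 h1 h2 [h3 h4 h5]; split=> //; last split=> //.
    by apply/det3_swap0/det3_perturb; [apply: det3_swap0|apply: (det3_scale0 eC)].
  by apply: det3_perturb => //; det_ring.
move=> hx; have [m2|[u0 b0 d]] := movableP A x1 x0 x5; first exact: one.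
apply: (Qc [:: fun t => x0 + t *: x1; fun=> x1; fun=> x2; fun=> x3; fun=> x4;
               fun=> x5; fun=> A; fun=> B; fun=> C]).
- by solve_curves.
- by rewrite /= scale0r addr0.
move=> t t0; apply: one => //; last exact: movable_perturb.
case: hx => hd h0 h1 h2 [h3 h4 h5]; split=> //; last split=> //.
  by apply: det3_perturb => //; det_ring.
by apply/det3_swap0/det3_perturb; [apply: det3_swap0|apply: (det3_scale0 eC)].
Qed.

(** Moving [C] off the common line in a direction [r] suitable for both of its sides leaves only [A]
    and [B] parallel, the case of [hexagon_two]. *)
Lemma hexagon_three Q A B C k m x0 x1 x2 x3 x4 x5 :
  curve_closed Q -> contains_hexagons Q ->
  A != 0 -> k != 0 -> m != 0 -> C = k *: A -> B = m *: A ->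
  hexagon x0 x1 x2 x3 x4 x5 A B C -> Q [:: x0; x1; x2; x3; x4; x5; A; B; C].
Proof.
move=> Qc H A0 k0 m0 eC eB.
have eA : A = m^-1 *: B by rewrite eB scalerA mulVf // scale1r.
have eAC : A = k^-1 *: C by rewrite eC scalerA mulVf // scale1r.
have B0 : B != 0 by rewrite eB scaler_eq0 negb_or m0.
have all4 y0 y1 y2 y3 y4 y5 : hexagon y0 y1 y2 y3 y4 y5 A B C ->
    movable A y4 y3 y2 -> movable A y1 y2 y3 ->
    movable A y1 y0 y5 -> movable A y4 y5 y0 ->
    Q [:: y0; y1; y2; y3; y4; y5; A; B; C].
  move=> hx m1 m2 m3 m4; have [_ h0 h1 h2 [h3 h4 h5]] := hx.
  have g0 := det3_swap0 h0; have g1 := det3_swap0 h1; have g2 := det3_swap0 h2.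
  have g3 := det3_swap0 h3; have g4 := det3_swap0 h4; have g5 := det3_swap0 h5.
  pose stuck := [&& cross y4 A != 0, cross y1 A != 0, cross y3 A != 0 & cross y2 A != 0].
  pose stuck' := [&& cross y1 A != 0, cross y4 A != 0, cross y0 A != 0 & cross y5 A != 0].
  (* If both sides are stuck, no vertex is on the line of [A]. Every side passes through this line,
     so going around the hexagon never leaves the plane of [A] and [y1]. *)
  have [/andP[/and4P[n4 n1 n3 n2] /and4P[_ _ n0 n5]]|nstuck] := boolP (stuck && stuck').
    apply: H; right; split=> //; exists A, y1.
    have step y z : cross y A != 0 -> det3 A y1 y = 0 -> det3 y z A = 0 -> det3 A y1 z = 0.
      move=> yA hy hyz; have [p [q ->]] := side_span yA hyz.
      have -> : det3 A y1 (p *: y + q *: A) = p * det3 A y1 y by det_ring.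
      by rewrite hy mulr0.
    have dd1 : det3 A y1 y1 = 0 by det_ring.
    have dd0 := step _ _ n1 dd1 g0.
    have dd2 := step _ _ n1 dd1 (det3_scale0 eA h1).
    have dd3 := step _ _ n2 dd2 (det3_scale0 eAC h2).
    have dd4 := step _ _ n3 dd3 h3.
    have dd5 := step _ _ n4 dd4 (det3_scale0 eA h4).
    have nA : cross A y1 != 0 by rewrite crossC oppr_eq0.
    do 9?[apply: spanned_cons => //]; try exact: spanned_nil.
    + by det_ring. + by rewrite eB; det_ring. + by rewrite eC; det_ring.
  (* At most one side is stuck: [r] is taken in its plane, while the other side can follow any
     direction. *)
  have [r rA hr] : exists2 r, cross r A != 0 &
      (stuck -> det3 y3 A r = 0) /\ (stuck' -> det3 y0 A r = 0).
    case: (boolP stuck) nstuck => [/and4P[n4 n1 n3 n2]|_] /= nstuck.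
      by exists y3 => //; split; [move=> _; det_ring|rewrite (negPf nstuck)].
    have [/and4P[_ _ n0 _]|n'] := boolP stuck'; first by exists y0 => //; split=> // _; det_ring.
    by have [r hr] := exists_cross_neq0 A0; exists r.
  have [u3 [v2 [cu3 cv2 e3 e2 hm1]]] : exists u' v' : K -> 'rV[K]_3,
    [/\ curve u', curve v', u' 0 = y3, v' 0 = y2
    & forall t, [/\ det3 y4 (u' t) A = 0, det3 (u' t) (v' t) (C + t *: r) = 0
                  & det3 (v' t) y1 B = 0]].
    apply: (move_side_three A0 k0 eC eB) => // n4 n1 n3 n2.
    by apply: hr.1; rewrite /stuck n4 n1 n3.
  have [u0 [v5 [cu0 cv5 e0 e5 hm2]]] : exists u' v' : K -> 'rV[K]_3,
    [/\ curve u', curve v', u' 0 = y0, v' 0 = y5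
    & forall t, [/\ det3 y1 (u' t) A = 0, det3 (u' t) (v' t) (C + t *: r) = 0
                  & det3 (v' t) y4 B = 0]].
    apply: (move_side_three A0 k0 eC eB) => // n1 n4 n0 n5.
    by apply: hr.2; rewrite /stuck' n1 n4 n0.
  apply: (Qc [:: u0; fun=> y1; v2; u3; fun=> y4; v5; fun=> A; fun=> B;
                 fun t => C + t *: r]).
  - by solve_curves.
  - by rewrite /= e0 e2 e3 e5 scale0r addr0.
  move=> t t0; have [a1 a2 a3] := hm1 t; have [b1 b2 b3] := hm2 t.
  (* After one rotation the diagonal points are [B], [C + t *: r], [A], with the first and last
     parallel, as [hexagon_two] expects. *)
  have := @hexagon_two (fun s => Q (rot_hexagon s)) B (C + t *: r) A m^-1
    y1 (v2 t) (u3 t) y4 (v5 t) (u0 t).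
  apply=> //.
  - exact: curve_closed_rot.
  - exact: contains_hexagons_rot.
  - by rewrite invr_eq0.
  - have -> : cross B (C + t *: r) = (- (m * t)) *: cross r A.
      by rewrite eB eC; vec_ring.
    by rewrite scaler_eq0 negb_or oppr_eq0 !mulf_neq0.
  - apply: hexagon_rot; split; [by rewrite eB; det_ring|exact: det3_swap0|exact: det3_swap0
           |exact: det3_swap0|split; exact: det3_swap0].
(* The points on the common line of A, B, C which cannot follow are first moved
   off it, one after the other. *)
have perturb1 b u v w t : det3 u v C = 0 -> det3 b v A = 0 -> det3 u b w = 0 ->
    det3 (u + t *: b) v C = 0 /\ det3 (u + t *: b) b w = 0.
  move=> h1 h2 h3; split; first by apply: det3_perturb; last apply: (det3_scale0 eC).
  by apply: det3_perturb => //; det_ring.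
have three y0 y1 y2 y3 y4 y5 : hexagon y0 y1 y2 y3 y4 y5 A B C ->
    movable A y1 y2 y3 -> movable A y1 y0 y5 -> movable A y4 y5 y0 ->
    Q [:: y0; y1; y2; y3; y4; y5; A; B; C].
  move=> hx m2 m3 m4; have [m1|[u0 b0 d]] := movableP A y4 y3 y2; first exact: all4.
  apply: (Qc [:: fun=> y0; fun=> y1; fun=> y2; fun t => y3 + t *: y4; fun=> y4;
                 fun=> y5; fun=> A; fun=> B; fun=> C]).
  - by solve_curves.
  - by rewrite /= scale0r addr0.
  case: hx => hd h0 h1 h2 [h3 h4 h5] t t0.
  have [p1 p2] := perturb1 y4 y3 y2 A t (det3_swap0 h2) d h3.
  apply: all4 => //; last 2 first.
  - exact: movable_perturb.
  (* Only the third alternative mentions [y3], and it cannot have held, as [y3] was on the line of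
     [A]. *)
  - case: m2 => [?|?|n]; [by constructor 1|by constructor 2|].
    have y3A : det3 y1 y3 A = 0.
      by have [q ->] := parallel A0 u0; det_ring.
    by rewrite y3A eqxx in n.
  - by split=> //; apply: det3_swap0.
have two y0 y1 y2 y3 y4 y5 : hexagon y0 y1 y2 y3 y4 y5 A B C ->
    movable A y1 y0 y5 -> movable A y4 y5 y0 ->
    Q [:: y0; y1; y2; y3; y4; y5; A; B; C].
  move=> hx m3 m4; have [m2|[u0 b0 d]] := movableP A y1 y2 y3; first exact: three.
  apply: (Qc [:: fun=> y0; fun=> y1; fun t => y2 + t *: y1; fun=> y3; fun=> y4;
                 fun=> y5; fun=> A; fun=> B; fun=> C]).
  - by solve_curves.
  - by rewrite /= scale0r addr0.
  case: hx => hd h0 h1 h2 [h3 h4 h5] t t0.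
  have [p1 p2] := perturb1 y1 y2 y3 B t h2 d (det3_swap0 h1).
  apply: three => //; last exact: movable_perturb.
  by split=> //; apply: det3_swap0.
have one y0 y1 y2 y3 y4 y5 : hexagon y0 y1 y2 y3 y4 y5 A B C ->
    movable A y4 y5 y0 -> Q [:: y0; y1; y2; y3; y4; y5; A; B; C].
  move=> hx m4; have [m3|[u0 b0 d]] := movableP A y1 y0 y5; first exact: two.
  apply: (Qc [:: fun t => y0 + t *: y1; fun=> y1; fun=> y2; fun=> y3; fun=> y4;
                 fun=> y5; fun=> A; fun=> B; fun=> C]).
  - by solve_curves.
  - by rewrite /= scale0r addr0.
  case: hx => hd h0 h1 h2 [h3 h4 h5] t t0.
  have [p1 p2] := perturb1 y1 y0 y5 A t (det3_swap0 h5) d h0.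
  apply: two => //; first 1 last.
  - exact: movable_perturb.
  - case: m4 => [?|?|n]; [by constructor 1|by constructor 2|].
    have y0A : det3 y4 y0 A = 0.
      by have [q ->] := parallel A0 u0; det_ring.
    by rewrite y0A eqxx in n.
  - by split=> //; split=> //; apply: det3_swap0.
move=> hx; have [m4|[u0 b0 d]] := movableP A x4 x5 x0; first exact: one.
apply: (Qc [:: fun=> x0; fun=> x1; fun=> x2; fun=> x3; fun=> x4;
               fun t => x5 + t *: x4; fun=> A; fun=> B; fun=> C]).
- by solve_curves.
- by rewrite /= scale0r addr0.
case: hx => hd h0 h1 h2 [h3 h4 h5] t t0.
have [p1 p2] := perturb1 x4 x5 x0 B t h5 d (det3_swap0 h4).
apply: one => //; last exact: movable_perturb.
by split=> //; split=> //; apply: det3_swap0.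
Qed.

Theorem hexagon_nonzero Q A B C x0 x1 x2 x3 x4 x5 :
  curve_closed Q -> contains_hexagons Q -> A != 0 -> B != 0 -> C != 0 ->
  hexagon x0 x1 x2 x3 x4 x5 A B C -> Q [:: x0; x1; x2; x3; x4; x5; A; B; C].
Proof.
move=> Qc H A0 B0 C0 hx.
have Qc1 := curve_closed_rot Qc; have Qc2 := curve_closed_rot Qc1.
have H1 := contains_hexagons_rot H; have H2 := contains_hexagons_rot H1.
have hx1 := hexagon_rot hx; have hx2 := hexagon_rot hx1.
have par y z : z != 0 -> y != 0 -> cross y z = 0 -> exists2 k, k != 0 & y = k *: z.
  move=> z0 y0 /(parallel z0)[k e]; exists k => //.
  by apply: contraNneq y0 => k0; rewrite e k0 scale0r.
have [CA|CA] := eqVneq (cross C A) 0.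
  have [k k0 eC] := par _ _ A0 C0 CA.
  have [AB|AB] := eqVneq (cross A B) 0; last exact: (hexagon_two Qc H A0 k0 eC).
  have BA : cross B A = 0 by rewrite crossC AB oppr0.
  have [m m0 eB] := par _ _ A0 B0 BA.
  exact: (hexagon_three Qc H A0 k0 m0 eC eB).
have [AB|AB] := eqVneq (cross A B) 0.
  have [k k0 eA] := par _ _ B0 A0 AB.
  apply: (hexagon_two Qc1 H1 B0 k0 eA) => //.
  have BA : cross B A = 0 by rewrite crossC AB oppr0.
  have [m m0 ->] := par _ _ A0 B0 BA.
  by rewrite crossZl scaler_eq0 negb_or m0 crossC oppr_eq0.
have [BC|BC] := eqVneq (cross B C) 0; last exact: hexagon_distinct.
have [k k0 eB] := par _ _ C0 B0 BC.
exact: (hexagon_two Qc2 H2 C0 k0 eB).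
Qed.

End ParallelDiagonalPoints.

(** * Quadrilaterals *)

Section Quadrilateral.
Variable K : numFieldType.
Implicit Types (x y z v : 'rV[K]_3) (k l : K).

(* The circuit variety of M(i): four points z on the remaining dependent lines,
   in cyclic order, each line carrying one more point y. *)
Definition quad z0 z1 z2 z3 y0 y1 y2 y3 : Prop :=
  [/\ det3 z0 z1 y0 = 0, det3 z1 z2 y1 = 0, det3 z2 z3 y2 = 0 & det3 z3 z0 y3 = 0].

(** For independent [z] and [z'] this is [det3 z z' y = 0]; for parallel ones it is strictly
    stronger, and that gap is what has to be closed by limits. *)
Definition in_span z z' y : Prop := exists k l, y = k *: z + l *: z'.

Definition contains_quads (Q : seq 'rV[K]_3 -> Prop) : Prop :=
  forall z0 z1 z2 z3 y0 y1 y2 y3,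
  in_span z0 z1 y0 -> in_span z1 z2 y1 -> in_span z2 z3 y2 -> in_span z3 z0 y3 ->
  Q [:: z0; z1; z2; z3; y0; y1; y2; y3].

Definition rot_quad (s : seq 'rV[K]_3) : seq 'rV[K]_3 :=
  [seq nth 0 s i | i <- [:: 3; 0; 1; 2; 7; 4; 5; 6]%N].

Lemma curve_closed_rot_quad Q :
  curve_closed Q -> curve_closed (fun s => Q (rot_quad s)).
Proof. exact: curve_closed_reindex. Qed.

Lemma contains_quads_rot Q : contains_quads Q -> contains_quads (fun s => Q (rot_quad s)).
Proof. by move=> H z1 z2 z3 z0 y1 y2 y3 y0 h1 h2 h3 h0; apply: (H z0 z1 z2 z3 y0 y1 y2 y3). Qed.

Lemma quad_rot z0 z1 z2 z3 y0 y1 y2 y3 :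
  quad z0 z1 z2 z3 y0 y1 y2 y3 -> quad z1 z2 z3 z0 y1 y2 y3 y0.
Proof. by case. Qed.

Lemma in_span_det3 z z' y : in_span z z' y -> det3 z z' y = 0.
Proof. by move=> [k [l ->]]; det_ring. Qed.

Lemma in_spanPn z z' y : det3 z z' y = 0 -> ~ in_span z z' y -> cross z z' = 0.
Proof.
by move=> d h; apply: contra_notP h => /eqP n; apply: span2.
Qed.

Lemma quad_fill Q z0 z1 z2 z3 y0 y1 y2 y3 : curve_closed Q ->
  quad z0 z1 z2 z3 y0 y1 y2 y3 ->
  (forall v, v != 0 -> quad z0 v z2 z3 y0 y1 y2 y3 ->
     (in_span z0 z1 y0 -> in_span z0 v y0) -> (in_span z1 z2 y1 -> in_span v z2 y1) ->
     Q [:: z0; v; z2; z3; y0; y1; y2; y3]) ->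
  Q [:: z0; z1; z2; z3; y0; y1; y2; y3].
Proof.
move=> Qc [h0 h1 h2 h3] H; have [z10|z1n] := eqVneq z1 0; last by apply: H.
have [v [v0 d0 d1]] := exists_perp z0 y0 z2 y1.
apply: (Qc [:: fun=> z0; fun t => t *: v; fun=> z2; fun=> z3;
               fun=> y0; fun=> y1; fun=> y2; fun=> y3]).
- by do 8!(split; first by poly_fun).
- by rewrite /= scale0r z10.
move=> t t0; apply: H; first by rewrite scaler_eq0 negb_or t0.
2: by rewrite z10 => -[k [l ->]]; exists k, 0; rewrite scaler0 scale0r.
2: by rewrite z10 => -[k [l ->]]; exists 0, l; rewrite scaler0 scale0r.
split=> //.
- have -> : det3 z0 (t *: v) y0 = - t * det3 z0 y0 v by det_ring.
  by rewrite d0 mulr0.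
- have -> : det3 (t *: v) z2 y1 = t * det3 z2 y1 v by det_ring.
  by rewrite d1 mulr0.
Qed.

(** If [y0] is outside the span, [z0] and [z1] are parallel, and [z0 + t *: y0] brings [y0] into the
    span. The other side at [z0] is kept by moving [y3] with constant coefficients, hence the span
    hypothesis on [y3]. *)
Lemma quad_open Q z0 z1 z2 z3 y0 y1 y2 y3 : curve_closed Q ->
  quad z0 z1 z2 z3 y0 y1 y2 y3 -> z1 != 0 -> in_span z3 z0 y3 ->
  (forall z0' y3', quad z0' z1 z2 z3 y0 y1 y2 y3' -> in_span z3 z0' y3' ->
     in_span z0' z1 y0 -> Q [:: z0'; z1; z2; z3; y0; y1; y2; y3']) ->
  Q [:: z0; z1; z2; z3; y0; y1; y2; y3].
Proof.
move=> Qc hq z1n s3 H; have [s0|s0] := pselect (in_span z0 z1 y0); first exact: H.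
have [h0 h1 h2 h3] := hq; have [c e] := parallel z1n (in_spanPn h0 s0).
have [a [b e3]] := s3.
apply: (Qc [:: fun t => z0 + t *: y0; fun=> z1; fun=> z2; fun=> z3;
               fun=> y0; fun=> y1; fun=> y2; fun t => a *: z3 + b *: (z0 + t *: y0)]).
- by do 8!(split; first by poly_fun).
- by rewrite /= scale0r addr0 e3.
move=> t t0; apply: H; last first.
- exists t^-1, (- (c / t)); rewrite e scalerDr !scalerA mulVf // scale1r.
  by rewrite addrAC mulrC -scalerDl subrr scale0r add0r.
- by exists a, b.
split=> //; last by move: (z0 + t *: y0) => z; det_ring.
have -> : det3 (z0 + t *: y0) z1 y0 = det3 z0 z1 y0 by det_ring.
by [].
Qed.

(** Here and in [quad_two] and [quad_one], [quad_open] gains the side after the last good one; a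
    rotation makes it the last. So a single good side spreads around the cycle. *)
Lemma quad_three Q z0 z1 z2 z3 y0 y1 y2 y3 : curve_closed Q -> contains_quads Q ->
  quad z0 z1 z2 z3 y0 y1 y2 y3 ->
  in_span z1 z2 y1 -> in_span z2 z3 y2 -> in_span z3 z0 y3 ->
  Q [:: z0; z1; z2; z3; y0; y1; y2; y3].
Proof.
move=> Qc H hq s1 s2 s3; apply: (quad_fill Qc hq) => v v0 hqv _ s1v.
by apply: (quad_open Qc hqv) => // z y _ *; apply: H => //; apply: s1v.
Qed.

Lemma quad_two Q z0 z1 z2 z3 y0 y1 y2 y3 : curve_closed Q -> contains_quads Q ->
  quad z0 z1 z2 z3 y0 y1 y2 y3 -> in_span z2 z3 y2 -> in_span z3 z0 y3 ->
  Q [:: z0; z1; z2; z3; y0; y1; y2; y3].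
Proof.
move=> Qc H hq s2 s3; apply: (quad_fill Qc hq) => v v0 hqv _ _.
apply: (quad_open Qc hqv) => // z y /quad_rot hz sy s0.
exact: (quad_three (curve_closed_rot_quad Qc) (contains_quads_rot H) hz).
Qed.

Lemma quad_one Q z0 z1 z2 z3 y0 y1 y2 y3 : curve_closed Q -> contains_quads Q ->
  quad z0 z1 z2 z3 y0 y1 y2 y3 -> in_span z3 z0 y3 ->
  Q [:: z0; z1; z2; z3; y0; y1; y2; y3].
Proof.
move=> Qc H hq s3; apply: (quad_fill Qc hq) => v v0 hqv _ _.
apply: (quad_open Qc hqv) => // z y /quad_rot hz sy s0.
exact: (quad_two (curve_closed_rot_quad Qc) (contains_quads_rot H) hz).
Qed.

Lemma quad_some Q z0 z1 z2 z3 y0 y1 y2 y3 : curve_closed Q -> contains_quads Q ->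
  quad z0 z1 z2 z3 y0 y1 y2 y3 ->
  [\/ in_span z0 z1 y0, in_span z1 z2 y1, in_span z2 z3 y2 | in_span z3 z0 y3] ->
  Q [:: z0; z1; z2; z3; y0; y1; y2; y3].
Proof.
move=> Qc H hq s.
have Qc1 := curve_closed_rot_quad Qc; have H1 := contains_quads_rot H.
have Qc2 := curve_closed_rot_quad Qc1; have H2 := contains_quads_rot H1.
have Qc3 := curve_closed_rot_quad Qc2; have H3 := contains_quads_rot H2.
have hq1 := quad_rot hq; have hq2 := quad_rot hq1; have hq3 := quad_rot hq2.
case: s => s; [exact: (quad_one Qc1 H1 hq1)|exact: (quad_one Qc2 H2 hq2)
  |exact: (quad_one Qc3 H3 hq3)|exact: (quad_one Qc H hq)].
Qed.

Lemma in_span_chord k k' l a y : k != 0 -> k' != 0 -> l != 0 ->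
  in_span (k *: a) (k' *: (a + l *: y)) y.
Proof.
move=> k0 k'0 l0; exists (- (l^-1 / k)), (l^-1 / k').
rewrite !scalerA mulNr !divfK // scalerDr scalerA mulVf // scale1r scaleNr.
by rewrite addrA addNr add0r.
Qed.

(* When the four points z are parallel, a linear relation between the four
   points y gives the closed polygon along which the z move apart. *)
Lemma quad_parallel Q z k1 k2 k3 y0 y1 y2 y3 : curve_closed Q -> contains_quads Q ->
  k1 != 0 -> k2 != 0 -> k3 != 0 ->
  Q [:: z; k1 *: z; k2 *: z; k3 *: z; y0; y1; y2; y3].
Proof.
move=> Qc H n1 n2 n3; have [l0 [l1 [l2 [l3 [n e]]]]] := relation4 y0 y1 y2 y3.
pose w1 := l0 *: y0; pose w2 := w1 + l1 *: y1; pose w3 := w2 + l2 *: y2.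
apply: (Qc [:: fun=> z; fun t => k1 *: (z + t *: w1); fun t => k2 *: (z + t *: w2);
               fun t => k3 *: (z + t *: w3); fun=> y0; fun=> y1; fun=> y2; fun=> y3]).
- by do 8!(split; first by poly_fun).
- by rewrite /= !scale0r !addr0.
move=> t t0.
have e1 : z + t *: w1 = z + (t * l0) *: y0 by vec_ring.
have e2 : z + t *: w2 = z + t *: w1 + (t * l1) *: y1 by vec_ring.
have e3 : z + t *: w3 = z + t *: w2 + (t * l2) *: y2 by vec_ring.
have e0 : z = z + t *: w3 + (t * l3) *: y3.
  by rewrite -addrA -scalerA -scalerDr e scaler0 addr0.
apply: (quad_some Qc H).
  split; last by rewrite {2}e0; move: (z + _) => a; det_ring.
  - by rewrite e1; det_ring.
  - by rewrite e2; move: (z + _) => a; det_ring.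
  - by rewrite e3; move: (z + _) => a; det_ring.
case/or4P: n => nl.
- by constructor 1; rewrite -{1}[z]scale1r e1; apply: in_span_chord; rewrite ?oner_eq0 ?mulf_neq0.
- by constructor 2; rewrite e2; apply: in_span_chord; rewrite ?mulf_neq0.
- by constructor 3; rewrite e3; apply: in_span_chord; rewrite ?mulf_neq0.
- constructor 4; rewrite -[X in in_span _ X _]scale1r [X in in_span _ (1 *: X) _]e0.
  by apply: in_span_chord; rewrite ?oner_eq0 ?mulf_neq0.
Qed.

(** Once the vertices are nonzero, either some side is good, or the failure of three sides makes all
    four vertices parallel, as in [quad_parallel]. *)
Theorem quad_all Q z0 z1 z2 z3 y0 y1 y2 y3 : curve_closed Q -> contains_quads Q ->
  quad z0 z1 z2 z3 y0 y1 y2 y3 -> Q [:: z0; z1; z2; z3; y0; y1; y2; y3].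
Proof.
move=> Qc H hq.
have Qc1 := curve_closed_rot_quad Qc; have H1 := contains_quads_rot H.
have Qc2 := curve_closed_rot_quad Qc1; have H2 := contains_quads_rot H1.
have Qc3 := curve_closed_rot_quad Qc2; have H3 := contains_quads_rot H2.
apply: (quad_fill Qc hq) => a1 n1 q1 _ _.
apply: (quad_fill Qc1 (quad_rot q1)) => a2 n2 q2 _ _.
apply: (quad_fill Qc2 (quad_rot q2)) => a3 n3 q3 _ _.
apply: (quad_fill Qc3 (quad_rot q3)) => a0 n0 q0 _ _.
have {hq q1 q2 q3 q0} q : quad a0 a1 a2 a3 y0 y1 y2 y3 by apply: quad_rot.
rewrite /rot_quad /=; have [h0 h1 h2 h3] := q.
have [s|s0] := pselect (in_span a0 a1 y0); first by apply: (quad_some Qc H q); constructor 1.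
have [s|s1] := pselect (in_span a1 a2 y1); first by apply: (quad_some Qc H q); constructor 2.
have [s|s2] := pselect (in_span a2 a3 y2); first by apply: (quad_some Qc H q); constructor 3.
have par u v : u != 0 -> v != 0 -> cross u v = 0 -> exists2 k, k != 0 & v = k *: u.
  move=> u0 v0; rewrite crossC => /eqP; rewrite oppr_eq0 => /eqP /(parallel u0)[k e].
  by exists k => //; apply: contraNneq v0 => k0; rewrite e k0 scale0r.
have [k1 k1n e1] := par _ _ n0 n1 (in_spanPn h0 s0).
have [k2 k2n e2] := par _ _ n1 n2 (in_spanPn h1 s1).
have [k3 k3n e3] := par _ _ n2 n3 (in_spanPn h2 s2).
rewrite e3 e2 e1 !scalerA; apply: quad_parallel => //; by rewrite !mulf_neq0.
Qed.

End Quadrilateral.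

(** * Zariski closed and irreducible sets *)

Local Open Scope classical_set_scope.

Section ZariskiTopology.
Variables (K : numFieldType) (n d : nat).
Implicit Types (Z X A B G : set 'M[K]_(n, d)) (g : 'M[K]_(n, d)).

Definition polymx (F : 'M[K]_(n, d) -> K) : Prop :=
  exists p : {mpoly K[n * d]}, forall g, F g = p.@[mxvec g 0].

Lemma polymx_ring : ring_closed polymx.
Proof.
split=> [k|f g [p hp] [q hq]|f g [p hp] [q hq]].
- by exists k%:MP_[n * d] => g; rewrite mevalC.
- by exists (p + q) => t; rewrite mevalD hp hq.
- by exists (p * q) => t; rewrite mevalM hp hq.
Qed.

Lemma polymx_entries : on_entries polymx id.
Proof. by move=> i j; exists 'X_(mxvec_index i j) => g; rewrite mevalXU mxvecE. Qed.

Lemma polyf_meval (p : {mpoly K[n * d]}) (c : K -> 'M[K]_(n, d)) :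
  curve c -> polyf (fun t => p.@[mxvec (c t) 0]).
Proof.
move=> cc; under eq_fun do rewrite mevalE.
apply: (rc_sum (polyf_ring K)) => m; apply: (rc_mul (polyf_ring K)).
  exact: (rc_cst (polyf_ring K)).
apply: (rc_prod (polyf_ring K)) => k; apply: (rc_exp (polyf_ring K)).
by case/mxvec_indexP: k => i j; under eq_fun do rewrite mxvecE.
Qed.

Lemma polyf_polymx F (c : K -> 'M[K]_(n, d)) :
  curve c -> polymx F -> polyf (fun t => F (c t)).
Proof. by move=> cc [p hp]; under eq_fun do rewrite hp; apply: polyf_meval. Qed.

Lemma zariski_closed_zero F : polymx F -> zariski_closed [set g | F g = 0].
Proof.
move=> [p hp]; exists [set p]; apply/seteqP; split=> [g /= Fg q ->|g /(_ p erefl)] /=.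
  by rewrite -hp.
by rewrite hp.
Qed.

Lemma zariski_closedI I (Z : I -> set 'M[K]_(n, d)) :
  (forall i, zariski_closed (Z i)) -> zariski_closed [set g | forall i, Z i g].
Proof.
move=> /choice[P hP]; exists [set p | exists i, P i p]; apply/seteqP; split=> g /=.
  by move=> h p [i Pip]; have := h i; rewrite hP; apply.
by move=> h i; rewrite hP => p Pip; apply: h; exists i.
Qed.

Lemma zariski_closedU A B :
  zariski_closed A -> zariski_closed B -> zariski_closed (A `|` B).
Proof.
move=> [P ->] [P' ->].
exists [set r | exists p q, [/\ P p, P' q & r = p * q]]; apply/seteqP; split=> g /=.
  by move=> [] h r [p [q [hp hq ->]]]; rewrite mevalM ?(h p hp) ?(h q hq) ?mul0r ?mulr0.
move=> h; apply: contrapT => /not_orP[/existsNP[p /not_implyP[hp pg]]].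
move=> /existsNP[q /not_implyP[hq qg]].
have /eqP := h (p * q) (ex_intro _ p (ex_intro _ q (And3 hp hq erefl))).
by rewrite mevalM mulf_eq0 => /orP[] /eqP.
Qed.

Lemma zariski_closed0 : zariski_closed (set0 : set 'M[K]_(n, d)).
Proof.
exists [set 1]; apply/seteqP; split=> // g /(_ 1 erefl)/eqP.
by rewrite meval1 oner_eq0.
Qed.

Lemma zariski_closure_closed G : zariski_closed (zariski_closure G).
Proof.
exists [set p | forall g, G g -> p.@[mxvec g 0] = 0]; apply/seteqP; split=> g.
  move=> hg p hp; apply: (hg [set g | p.@[mxvec g 0] = 0]); split=> //.
  by apply: zariski_closed_zero; exists p.
move=> hg _ [[P ->] GP] p Pp; apply: hg => g' /GP; exact.
Qed.

Lemma sub_zariski_closure G : G `<=` zariski_closure G.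
Proof. exact: sub_gen_smallest. Qed.

Lemma zariski_closure_sub G Z : zariski_closed Z -> G `<=` Z -> zariski_closure G `<=` Z.
Proof. exact: smallest_sub. Qed.

(** For each equation [p] of [Z], the product of [h] and [p] along [c] vanishes identically, and [h]
    is not the zero polynomial. *)
Lemma zariski_closed_curve Z (c : K -> 'M[K]_(n, d)) h a : zariski_closed Z ->
  curve c -> polyf h -> h a != 0 -> (forall t, h t != 0 -> Z (c t)) ->
  forall t, Z (c t).
Proof.
move=> [P ->] cc ph ha hZ t p Pp; apply/eqP/negPn/negP => pt.
have [u] := polyf_mul_neq0 ph (polyf_meval p cc) ha pt.
rewrite mulf_eq0 negb_or => /andP[hu]; apply/negP/negPn/eqP; exact: hZ.
Qed.

(** The zeros of [h] are finitely many parameters at which the curve may leave [G]; 0 and 1 may be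
    among them, so [x] and [y] need not lie in [G]. *)
Definition joined G (x y : 'M[K]_(n, d)) : Prop := exists c h a,
  [/\ curve c, polyf h, c 0 = x /\ c 1 = y, h a != 0 & forall t, h t != 0 -> G (c t)].

Lemma irreducible_closure G : G !=set0 ->
  (forall x y, G x -> G y -> joined G x y) -> irreducible (zariski_closure G).
Proof.
move=> [g0 Gg0] J; split; first by exists g0; apply: sub_zariski_closure.
move=> A B cA cB GAB.
have {}GAB : G `<=` A `|` B by move=> g /sub_zariski_closure/GAB.
suff [h|h] : G `<=` A \/ G `<=` B.
- by left; apply: zariski_closure_sub.
- by right; apply: zariski_closure_sub.
apply: contrapT => /not_orP[/existsNP[x /not_implyP[Gx Ax]]].
move=> /existsNP[y /not_implyP[Gy By]].
have [P eA] := cA; have [P' eB] := cB.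
move: Ax; rewrite {1}eA => /existsNP[p /not_implyP[Pp px]].
move: By; rewrite {1}eB => /existsNP[q /not_implyP[Pq qy]].
have [c [h [a [cc ph [c0 c1] ha Gc]]]] := J x y Gx Gy.
have pc0 : p.@[mxvec (c 0) 0] != 0 by rewrite c0; apply/eqP.
have qc1 : q.@[mxvec (c 1) 0] != 0 by rewrite c1; apply/eqP.
have [u hu] := polyf_mul_neq0 (polyf_meval p cc) (polyf_meval q cc) pc0 qc1.
have pq : polyf (fun t => p.@[mxvec (c t) 0] * q.@[mxvec (c t) 0]).
  by apply: (rc_mul (polyf_ring K)); apply: polyf_meval.
have [v] := polyf_mul_neq0 ph pq ha hu.
rewrite !mulf_eq0 !negb_or => /and3P[hv pv qv].
have [] := GAB _ (Gc v hv).
  by rewrite eA => /(_ p Pp)/eqP; rewrite (negPf pv).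
by rewrite eB => /(_ q Pq)/eqP; rewrite (negPf qv).
Qed.

Lemma irreducible_bigU Z (s : seq (set 'M[K]_(n, d))) : irreducible Z ->
  (forall Y, Y \in s -> zariski_closed Y) -> Z `<=` \big[setU/set0]_(Y <- s) Y ->
  exists2 Y, Y \in s & Z `<=` Y.
Proof.
move=> [[z Zz] irrZ]; elim: s => [|Y s IH] cs.
  by rewrite big_nil => /(_ z Zz).
have cls : zariski_closed (\big[setU/set0]_(Y <- s) Y).
  rewrite big_seq; apply: (big_ind (@zariski_closed _ _ _)).
  - exact: zariski_closed0.
  - exact: zariski_closedU.
  - by move=> X hX; apply: cs; rewrite in_cons hX orbT.
rewrite big_cons => /(irrZ _ _ (cs Y (mem_head _ _)) cls)[h|/IH[]].
- by exists Y; rewrite ?mem_head.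
- by move=> X hX; apply: cs; rewrite in_cons hX orbT.
- by move=> X hX; exists X; rewrite // in_cons hX orbT.
Qed.

Lemma irreducible_decomposition_of X (s : seq (set 'M[K]_(n, d))) :
  X = \big[setU/set0]_(Z <- s) Z ->
  (forall Z, Z \in s -> zariski_closed Z) ->
  (forall Z, Z \in s -> irreducible Z) ->
  (forall i j, (i < size s)%N -> (j < size s)%N -> i != j ->
     ~ nth set0 s i `<=` nth set0 s j) ->
  irreducible_decomposition X s.
Proof.
move=> eX cs irrs sep.
have subX Y : Y \in s -> Y `<=` X.
  by move=> Ys; rewrite eX (big_rem Y) //=; apply: subsetUl.
have anti Z Y : Z \in s -> Y \in s -> Z `<=` Y -> Z = Y.
  move=> /(nthP set0)[i hi <-] /(nthP set0)[j hj <-] h; congr nth.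
  by apply: contrapT => /eqP/(sep i j hi hj).
split=> // [|Z].
  apply/(uniqP set0) => i j hi hj e; apply: contrapT => /eqP/(sep i j hi hj).
  by apply; rewrite e.
split=> [[ZX irrZ maxZ]|Zs].
  have [|Y Ys ZY] := irreducible_bigU irrZ cs; first by rewrite -eX.
  by rewrite -(maxZ Y (subX Y Ys) (irrs Y Ys) ZY).
split; [exact: subX|exact: irrs|move=> Y YX irrY ZY].
have [|W Ws YW] := irreducible_bigU irrY cs; first by rewrite -eX.
have ZW := anti _ _ Zs Ws (subset_trans ZY YW).
by apply/seteqP; split=> //; rewrite ZW.
Qed.

End ZariskiTopology.

(** * Realizations of matroids of rank at most three *)

Section ListsOfVectors.
Variable K : fieldType.
Implicit Types (x y z : 'rV[K]_3) (X : seq 'rV[K]_3).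

Definition dependent_seq X : bool :=
  match X with
  | [::] => false
  | [:: x] => x == 0
  | [:: x; y] => cross x y == 0
  | [:: x; y; z] => det3 x y z == 0
  | _ => true
  end.

Lemma free_dependent_seq X : ~~ free X = dependent_seq X.
Proof.
case: X => [|x [|y [|z [|w X]]]] /=.
- by rewrite nil_free.
- by rewrite seq1_free negbK.
- apply/idP/idP => [nf|/eqP h]; last first.
    have [k [l [n e]]] := dependent2 h; apply/negP => /(@freeP _ _ _ [tuple x; y]) f.
    have := f (fun i => if i == 0 then k else l).
    rewrite !big_ord_recl big_ord0 addr0 /= e => /(_ erefl) f0.
    by move: n (f0 0) (f0 1) => /= n k0 l0; rewrite k0 l0 eqxx in n.
  apply: contraNT nf => n; apply/(@freeP _ _ _ [tuple x; y]) => k.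
  rewrite !big_ord_recl big_ord0 addr0 /= => e.
  have e0 : cross (k ord0 *: x + k (lift ord0 ord0) *: y) y = k ord0 *: cross x y by vec_ring.
  have e1 : cross x (k ord0 *: x + k (lift ord0 ord0) *: y) = k (lift ord0 ord0) *: cross x y.
    by vec_ring.
  move: e0 e1; rewrite e cross0v crossv0 => /esym/eqP + /esym/eqP.
  rewrite !scaler_eq0 (negPf n) !orbF => /eqP k0 /eqP k1 [[|[|//]] lt].
    by rewrite -[RHS]k0; congr k; apply: val_inj.
  by rewrite -[RHS]k1; congr k; apply: val_inj.
- apply/idP/idP => [nf|/eqP/det3_eq0P[k [l [m [n e]]]]]; last first.
    apply/negP => /(@freeP _ _ _ [tuple x; y; z]) f.
    have := f (fun i => if i == 0 then k else if i == 1 then l else m).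
    rewrite !big_ord_recl big_ord0 addr0 addrA /= e => /(_ erefl) f0.
    by move: n (f0 0) (f0 1) (f0 2) => /= n k0 l0 m0; rewrite k0 l0 m0 eqxx in n.
  apply: contraNT nf => n; apply/(@freeP _ _ _ [tuple x; y; z]) => k.
  rewrite !big_ord_recl big_ord0 addr0 /= => e i; apply: contraNeq n => ki.
  apply/eqP/det3_eq0P; exists (k 0), (k 1), (k 2); split.
    by elim/ord3P: i ki => ->; rewrite ?orbT.
  by rewrite -[RHS]e -addrA; congr (k _ *: _ + (k _ *: _ + k _ *: _)); apply: val_inj.
- apply/negP => /eqP f; have := dimvS (subvf <<[:: x, y, z, w & X]>>).
  by rewrite f dimvf.
Qed.

Lemma dependent_seq_perm X Y : perm_eq X Y -> dependent_seq X = dependent_seq Y.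
Proof. by rewrite -!free_dependent_seq => /perm_free->. Qed.

Lemma dependent_seq0 X : 0 \in X -> dependent_seq X.
Proof.
move=> X0; rewrite -free_dependent_seq; apply/negP => /free_not0/(_ X0).
by rewrite eqxx.
Qed.

Lemma dependent_seq_size X : (3 < size X)%N -> dependent_seq X.
Proof. by case: X => [|x [|y [|z [|w X]]]]. Qed.

End ListsOfVectors.

(** * Openness of independence, and irreducibility from a connected family *)

Section IndependenceIsOpen.
Variables (K : numFieldType) (n : nat).
Implicit Types (g : 'M[K]_(n, 3)) (S : {set 'I_n}).

Lemma lin_dependent_rowsub g S :
  lin_dependent g S = ~~ row_free (rowsub (@enum_val _ (mem S)) g).
Proof.
congr (~~ _); set A := rowsub _ g.
have nthE (i : 'I_#|S|) : (image_tuple (fun j => row j g) (mem S))`_i = row i A.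
  by rewrite nth_image row_rowsub.
apply/(@freeP _ _ _ (image_tuple (fun j => row j g) (mem S)))/idP => [f|f k].
  apply: inj_row_free => v; rewrite mulmx_sum_row => e.
  apply/rowP => i; rewrite mxE; apply: f.
  by rewrite -[RHS]e; apply: eq_bigr => j _; rewrite nthE.
move=> e i; have : (\row_j k j) *m A == 0.
  rewrite mulmx_sum_row -[X in _ == X]e; apply/eqP; apply: eq_bigr => j _.
  by rewrite nthE mxE.
by rewrite mulmx_free_eq0 // => /eqP/rowP/(_ i); rewrite !mxE.
Qed.

(* Independence of the rows of g in S is witnessed by the determinant of the
   product of these rows with a right inverse. *)
Lemma lin_independent_open g S : exists F, [/\ polymx F,
  ~~ lin_dependent g S -> F g != 0 & forall g', F g' != 0 -> ~~ lin_dependent g' S].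
Proof.
pose r (g' : 'M[K]_(n, 3)) := rowsub (@enum_val _ (mem S)) g'.
exists (fun g' => \det (r g' *m pinvmx (r g))); split.
- apply: (rc_det (@polymx_ring K n 3)); apply: (rc_mxmul (@polymx_ring K n 3)).
    by move=> i j; under eq_fun do rewrite mxE; apply: polymx_entries.
  exact: (rc_mxcst (@polymx_ring K n 3)).
- by rewrite lin_dependent_rowsub negbK => f; rewrite mulmxVp // det1 oner_eq0.
- move=> g' h; rewrite lin_dependent_rowsub negbK; apply/row_freeP.
  exists (pinvmx (r g) *m invmx (r g' *m pinvmx (r g))).
  by rewrite mulmxA mulmxV // unitmxE unitfE.
Qed.

Variables (N : matroid 'I_n) (W : set 'M[K]_(n, 3)).
Hypothesis realizable : realization_space K N !=set0.
Hypothesis sub_W : realization_space K N `<=` W.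
Hypothesis W_sub : W `<=` circuit_variety K N.
Hypothesis W_joined : forall x y, W x -> W y ->
  exists c, [/\ curve c, c 0 = x, c 1 = y & forall t, W (c t)].

Lemma joined_realization x y : W x -> realization_space K N y ->
  joined (realization_space K N) x y.
Proof.
move=> Wx Ny; have [c [cc c0 c1 cW]] := W_joined Wx (sub_W Ny).
have [F hF] := choice (lin_independent_open y).
(* Dependences hold along all of [W]; independences are certified by the product of the witnesses
   chosen at [y], which is nonzero at parameter 1. *)
exists c, (fun t => \prod_(S <- [seq S <- enum {set 'I_n} | ~~ dependent N S]) F S (c t)), 1.
split=> //.
- apply: (rc_prod (polyf_ring K)) => S; apply: polyf_polymx => //.
  by have [] := hF S.
- rewrite prodf_seq_neq0; apply/allP => S; rewrite mem_filter => /andP[NS _].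
  have [_ h _] := hF S; rewrite implyTb c1 h //.
  by apply: contra NS => /(Ny S).
- move=> t ht S; split; first exact: W_sub.
  apply: contraTT => NS; have [_ _] := hF S; apply.
  move: ht; rewrite prodf_seq_neq0 => /allP/(_ S); rewrite implyTb; apply.
  by rewrite mem_filter NS mem_enum.
Qed.

Lemma matroid_variety_irreducible : irreducible (matroid_variety K N).
Proof.
apply: irreducible_closure realizable _ => x y /sub_W; exact: joined_realization.
Qed.

Lemma sub_matroid_variety : W `<=` matroid_variety K N.
Proof.
move=> x Wx; have [y Ny] := realizable.
have [c [h [a [cc ph [<- _] ha hc]]]] := joined_realization Wx Ny.
apply: (zariski_closed_curve (@zariski_closure_closed _ _ _ _) cc ph ha) => t /hc.
exact: sub_zariski_closure.
Qed.

End IndependenceIsOpen.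

Lemma curve_closed_matrix (K : numFieldType) n (Z : set 'M[K]_(n, 3))
  (m : seq 'rV[K]_3 -> 'M[K]_(n, 3)) :
  zariski_closed Z ->
  (forall fs, curves fs -> curve (fun t => m [seq f t | f <- fs])) ->
  curve_closed (fun s => Z (m s)).
Proof.
move=> cZ cm fs s cfs <- h.
apply: (zariski_closed_curve (h := fun t => t) (a := 1) cZ (cm _ cfs)) => //.
- by poly_fun.
- by rewrite oner_eq0.
Qed.

(** * Subsets of [9] as increasing lists of labels *)

Section Labels.
Implicit Types (S : {set 'I_9}) (l : seq nat).

Definition labels S : seq nat := [seq i.+1 | i : 'I_9 <- enum S].

Lemma pointK k : k \in iota 1 9 -> (point k).+1 = k.
Proof. by rewrite mem_iota => /andP[k0 k9]; rewrite /point inordK prednK. Qed.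

Lemma succ_label (i : 'I_9) : i.+1 \in iota 1 9.
Proof. by rewrite mem_iota; apply: (ltn_ord i). Qed.

Lemma point_succ (i : 'I_9) : point i.+1 = i.
Proof. by rewrite /point inord_val. Qed.

Lemma labels_filter S : labels S = [seq k <- iota 1 9 | point k \in S].
Proof.
rewrite (iotaDl 1 0 9) -val_enum_ord -map_comp filter_map /labels {1}/enum_mem -enumT.
by congr map; apply: eq_filter => i; rewrite /= add1n point_succ.
Qed.

Lemma labels_subseq S : subseq (labels S) (iota 1 9).
Proof. by rewrite labels_filter filter_subseq. Qed.

Lemma mem_labels S k : k \in iota 1 9 -> (k \in labels S) = (point k \in S).
Proof. by rewrite labels_filter mem_filter => ->; rewrite andbT. Qed.

Lemma labelled_labels S : labelled (labels S) = S.
Proof.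
by apply/setP => i; rewrite inE mem_labels ?point_succ ?succ_label.
Qed.

Lemma labels_labelled l : subseq l (iota 1 9) -> labels (labelled l) = l.
Proof.
move=> sl; rewrite labels_filter [RHS](subseq_uniqP (iota_uniq 1 9) sl).
by apply: eq_in_filter => k hk; rewrite inE pointK.
Qed.

Lemma size_labels S : size (labels S) = #|S|.
Proof. by rewrite size_map cardE. Qed.

Definition sort_labels l : seq nat := [seq k <- iota 1 9 | k \in l].

Lemma perm_sort_labels l : uniq l -> all (mem (iota 1 9)) l -> perm_eq l (sort_labels l).
Proof.
move=> ul /allP al; apply: uniq_perm; rewrite ?filter_uniq ?iota_uniq //.
by move=> k; rewrite mem_filter andb_idr // => /al.
Qed.

End Labels.

(* The dependent sets of a matroid on [9] as a predicate on increasing lists of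
   labels. *)
Definition dependence (N : matroid 'I_9) (D : pred (seq nat)) : Prop :=
  forall S, dependent N S = D (labels S).

Definition pascal_dependence : pred (seq nat) :=
  fun l => (3 < size l)%N || (l \in pascal_triples).

Definition loop_dependence (i : nat) : pred (seq nat) :=
  fun l => (i \in l) || pascal_dependence l.

Definition line_dependence : pred (seq nat) := fun l => (2 < size l)%N.

Section Dependence.
Implicit Types (M N : matroid 'I_9).

Lemma pascal_triples_subseq s : s \in pascal_triples -> subseq s (iota 1 9) && (size s == 3).
Proof. by move: s; apply/allP; vm_compute. Qed.

Lemma pascal_linesE (S : {set 'I_9}) : (S \in pascal_lines) = (labels S \in pascal_triples).
Proof.
apply/idP/idP => [|h]; last first.
  rewrite -(labelled_labels S) inE; exact: (map_f labelled h).
rewrite inE => /mapP[s hs ->]; have /andP[ss _] := pascal_triples_subseq hs.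
by rewrite labels_labelled.
Qed.

Lemma dependence_pascal M : is_pascal M -> dependence M pascal_dependence.
Proof.
move=> [simM rkM lines] S; rewrite /pascal_dependence size_labels -pascal_linesE.
apply/idP/orP => [/exists_inP[C CM CS]|[S4|SL]].
- have C3 := simM C CM; case: ltnP => S3; [by left|right].
  have e : C = S by apply/eqP; rewrite eqEcard CS (leq_trans S3).
  rewrite -e -lines //; apply/eqP; rewrite eqn_leq C3 andbT.
  by rewrite e.
- apply: contraLR S4 => nd; rewrite -leqNgt; apply: leq_trans (eq_leq rkM).
  exact: (leq_bigmax_cond (F := fun S : {set 'I_9} => #|S|)).
- apply/exists_inP; exists S => //; rewrite lines //.
  rewrite pascal_linesE in SL; have /andP[_ /eqP] := pascal_triples_subseq SL.
  by rewrite size_labels.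
Qed.

Lemma dependence_uniform : dependence (uniform 'I_9 2) line_dependence.
Proof.
move=> S; rewrite /line_dependence size_labels; apply/exists_inP/idP => [[C]|].
  by rewrite inE => /eqP C3 /subset_leq_card; rewrite C3.
by case/ex_subset_card => E E3 ES; exists E; rewrite // inE E3.
Qed.

Lemma dependence_loop M i : dependence M pascal_dependence -> i \in iota 1 9 ->
  dependence (make_loop M (point i)) (loop_dependence i).
Proof.
move=> dM hi S; rewrite /loop_dependence -dM mem_labels //.
apply/exists_inP/orP => [[C /loop_circuitsP[->|[CM iC]] CS]|[iS|/exists_inP[C CM CS]]].
- by left; move: CS; rewrite finset.sub1set.
- by right; apply/exists_inP; exists C.
- by exists [set point i]%SET; [apply/loop_circuitsP; left|rewrite finset.sub1set].
- have [iC|iC] := boolP (point i \in C).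
    exists [set point i]%SET; first by apply/loop_circuitsP; left.
    by rewrite finset.sub1set (fintype.subsetP CS).
  by exists C => //; apply/loop_circuitsP; right.
Qed.

End Dependence.

Section Realizations.
Variable K : numFieldType.
Implicit Types (g : 'M[K]_(9, 3)) (S : {set 'I_9}) (l : seq nat) (N : matroid 'I_9).

Definition vec g (k : nat) : 'rV[K]_3 := row (point k) g.

Lemma lin_dependentE g S : lin_dependent g S = dependent_seq [seq vec g k | k <- labels S].
Proof.
rewrite /lin_dependent free_dependent_seq -map_comp; congr dependent_seq.
by apply: eq_map => i; rewrite /= /vec point_succ.
Qed.

Lemma realization_spaceE N D g : dependence N D ->
  realization_space K N g <->
  forall l, subseq l (iota 1 9) -> D l = dependent_seq [seq vec g k | k <- l].
Proof.
move=> hD; split=> [h l sl|h S].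
  have := h (labelled l); rewrite hD lin_dependentE labels_labelled // => e.
  by apply/idP/idP => /e.
by rewrite hD lin_dependentE h // labels_subseq.
Qed.

Lemma circuit_varietyE N D g : dependence N D ->
  circuit_variety K N g <->
  forall l, subseq l (iota 1 9) -> D l -> dependent_seq [seq vec g k | k <- l].
Proof.
move=> hD; split=> [h l sl|h S].
  by have := h (labelled l); rewrite hD lin_dependentE labels_labelled.
by rewrite hD lin_dependentE; apply/h/labels_subseq.
Qed.

Lemma realization_dependent N D g l : dependence N D -> realization_space K N g ->
  uniq l -> all (mem (iota 1 9)) l ->
  dependent_seq [seq vec g k | k <- l] = D (sort_labels l).
Proof.
move=> hD /(realization_spaceE _ hD) h ul al.
rewrite (dependent_seq_perm (perm_map (vec g) (perm_sort_labels ul al))).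
by rewrite -h // filter_subseq.
Qed.

Lemma circuit_variety_dependent N D g l : dependence N D -> circuit_variety K N g ->
  uniq l -> all (mem (iota 1 9)) l -> D (sort_labels l) ->
  dependent_seq [seq vec g k | k <- l].
Proof.
move=> hD /(circuit_varietyE _ hD) h ul al dl.
rewrite (dependent_seq_perm (perm_map (vec g) (perm_sort_labels ul al))).
by rewrite h // filter_subseq.
Qed.

(** [ls] is the order in which [s] gives the vectors, so that hexagons and quadrilaterals can be
    listed cyclically. *)
Definition config (ls : seq nat) (s : seq 'rV[K]_3) : 'M[K]_(9, 3) :=
  \matrix_(i < 9) nth 0 s (index i.+1 ls).

Lemma vec_config ls s k : k \in iota 1 9 -> vec (config ls s) k = nth 0 s (index k ls).
Proof. by move=> hk; rewrite /vec rowK pointK. Qed.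

Lemma config_vec ls g : all (mem ls) (iota 1 9) -> config ls [seq vec g k | k <- ls] = g.
Proof.
move=> /allP h; apply/row_matrixP => i; rewrite rowK.
have hi : i.+1 \in ls by apply: h; apply: succ_label.
by rewrite (nth_map 0%N) ?index_mem // nth_index // /vec point_succ.
Qed.

Lemma curve_config ls fs : curves fs -> curve (fun t => config ls [seq f t | f <- fs]).
Proof.
move=> cfs i j; under eq_fun do rewrite mxE.
have := curves_nth (index i.+1 ls) cfs => /(_ 0 j); congr polyf.
apply: funext => t; have [h|h] := ltnP (index i.+1 ls) (size fs).
  by rewrite (nth_map (fun=> 0)).
by rewrite !nth_default ?size_map.
Qed.

End Realizations.

(** * Realizations with integer coordinates, checked by computation *)

Section IntegerRealizations.
Variable K : numFieldType.
Local Notation vecZ := (int * int * int)%type.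

Definition crossZ (x y : vecZ) : vecZ :=
  let: (x0, x1, x2) := x in let: (y0, y1, y2) := y in
  (x1 * y2 - x2 * y1, x2 * y0 - x0 * y2, x0 * y1 - x1 * y0).

Definition det3Z (x y z : vecZ) : int :=
  let: (x0, x1, x2) := x in let: (c0, c1, c2) := crossZ y z in
  x0 * c0 + x1 * c1 + x2 * c2.

Definition dependent_seqZ (X : seq vecZ) : bool :=
  match X with
  | [::] => false
  | [:: x] => x == (0, 0, 0)
  | [:: x; y] => crossZ x y == (0, 0, 0)
  | [:: x; y; z] => det3Z x y z == 0
  | _ => true
  end.

Definition of_vecZ (x : vecZ) : 'rV[K]_3 :=
  \row_(j < 3) [:: x.1.1%:~R; x.1.2%:~R; x.2%:~R]`_j.

Lemma of_vecZ0 x : (of_vecZ x == 0) = (x == (0, 0, 0)).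
Proof.
case: x => [[a b] c]; apply/eqP/eqP => [/rowP h|[-> -> ->]].
  move: (h 0) (h 1) (h 2); rewrite !mxE /= => /eqP h0 /eqP h1 /eqP h2.
  by move: h0 h1 h2; rewrite !intr_eq0 => /eqP-> /eqP-> /eqP->.
by apply: vec3P; rewrite !mxE /= mulr0z.
Qed.

Lemma cross_of_vecZ x y : cross (of_vecZ x) (of_vecZ y) = of_vecZ (crossZ x y).
Proof.
case: x y => [[x0 x1] x2] [[y0 y1] y2].
by apply: vec3P; rewrite crossE !mxE /= rmorphB !rmorphM.
Qed.

Lemma det3_of_vecZ x y z : det3 (of_vecZ x) (of_vecZ y) (of_vecZ z) = (det3Z x y z)%:~R.
Proof.
case: x y z => [[x0 x1] x2] [[y0 y1] y2] [[z0 z1] z2].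
by rewrite /det3 !mxE /= !(rmorphB, rmorphD, rmorphM).
Qed.

Lemma dependent_of_vecZ X : dependent_seq [seq of_vecZ x | x <- X] = dependent_seqZ X.
Proof.
case: X => [|x [|y [|z [|w X]]]] //=; first exact: of_vecZ0.
  by rewrite cross_of_vecZ of_vecZ0.
by rewrite det3_of_vecZ intr_eq0.
Qed.

Fixpoint sublists (l : seq nat) : seq (seq nat) :=
  if l is x :: l' then let r := sublists l' in [seq x :: m | m <- r] ++ r
  else [:: [::]].

Lemma mem_sublists l m : subseq m l -> m \in sublists l.
Proof.
elim: l m => [|x l IH] m; first by rewrite subseq0 inE.
rewrite /= mem_cat; case: m => [_|y m]; first by rewrite IH ?sub0seq ?orbT.
case: eqP => [->|_] h; apply/orP; [left|by right; apply: IH].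
by apply: (map_f (cons x)); apply: IH.
Qed.

Definition configZ (e : seq vecZ) : 'M[K]_(9, 3) := config (iota 1 9) [seq of_vecZ x | x <- e].

Lemma vec_configZ e k : k \in iota 1 9 -> vec (configZ e) k = of_vecZ (nth (0, 0, 0) e k.-1).
Proof.
move=> hk; rewrite vec_config //.
have -> : index k (iota 1 9) = k.-1.
  by apply/eqP; move: k hk; apply/allP; vm_compute.
have [h|h] := ltnP k.-1 (size e); first by rewrite (nth_map (0, 0, 0)).
by rewrite !nth_default ?size_map //; apply/esym/eqP; rewrite of_vecZ0.
Qed.

(** All 512 increasing lists of labels are tested over the integers; characteristic zero transfers
    the result to [K]. *)
Lemma realization_configZ N D e : dependence N D ->
  all (fun l => D l == dependent_seqZ [seq nth (0, 0, 0) e k.-1 | k <- l])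
      (sublists (iota 1 9)) ->
  realization_space K N (configZ e).
Proof.
move=> hD /allP h; apply/(realization_spaceE _ hD) => l sl.
rewrite (eqP (h l (mem_sublists sl))) -dependent_of_vecZ -map_comp; congr dependent_seq.
by apply/esym/eq_in_map => k /(mem_subseq sl) hk; rewrite vec_configZ.
Qed.

End IntegerRealizations.

Section Segments.
Variable K : numFieldType.

Definition segment (V : lmodType K) (x y : V) (t : K) : V := x + t *: (y - x).

Lemma segment0 (V : lmodType K) (x y : V) : segment x y 0 = x.
Proof. by rewrite /segment scale0r addr0. Qed.

Lemma segment1 (V : lmodType K) (x y : V) : segment x y 1 = y.
Proof. by rewrite /segment scale1r addrC subrK. Qed.

Lemma curve_segment m n (x y : 'M[K]_(m, n)) : curve (segment x y).
Proof. by rewrite /curve /segment; poly_fun. Qed.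

Lemma polyf_segment (x y : K) : polyf (segment (x : K^o) y).
Proof. by rewrite /segment; poly_fun. Qed.

End Segments.

Ltac segment_fun := repeat first
  [ assumption
  | apply: curve_segment
  | apply: polyf_segment
  | exact: (rc_mxcst (polyf_ring _))
  | apply: (rc_mxadd (polyf_ring _))
  | apply: (rc_mxscale (polyf_ring _))
  | apply: (rc_cross (polyf_ring _)) ].

(** * The families of realizations *)

Section Parametrizations.
Variable K : numFieldType.
Implicit Types (g : 'M[K]_(9, 3)) (z y v : 'rV[K]_3).

(** The cross product of the intersection with [d] is [det3 a b d *: cross c d], which is
    nonzero. *)
Lemma meet_neq0 (a b c d : 'rV[K]_3) : det3 a b d != 0 -> cross c d != 0 ->
  cross (cross a b) (cross c d) != 0.
Proof.
move=> n; apply: contraNneq => e; have : det3 a b d *: cross c d = 0.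
  have -> : det3 a b d *: cross c d = cross (cross (cross a b) (cross c d)) d.
    by rewrite cross_cross; move: (det3 a b d) (det3 a b c) => k l; vec_ring.
  by rewrite e cross0v.
by move/eqP; rewrite scaler_eq0 (negPf n).
Qed.

Definition pascal_vectors v1 v2 v3 v7 v8 (a b k4 k5 k6 : K) : seq 'rV[K]_3 :=
  let v9 := a *: v7 + b *: v8 in
  [:: v1; v2; v3;
      k4 *: cross (cross v2 v7) (cross v3 v8);
      k5 *: cross (cross v1 v7) (cross v3 v9);
      k6 *: cross (cross v1 v8) (cross v2 v9); v7; v8; v9].

Definition pascal_family : set 'M[K]_(9, 3) :=
  [set g | exists v1 v2 v3 v7 v8 a b k4 k5 k6,
     g = config (iota 1 9) (pascal_vectors v1 v2 v3 v7 v8 a b k4 k5 k6)].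

Lemma pascal_family_joined g g' : pascal_family g -> pascal_family g' ->
  exists c, [/\ curve c, c 0 = g, c 1 = g' & forall t, pascal_family (c t)].
Proof.
move=> [v1 [v2 [v3 [v7 [v8 [a [b [k4 [k5 [k6 ->]]]]]]]]]].
move=> [w1 [w2 [w3 [w7 [w8 [a' [b' [l4 [l5 [l6 ->]]]]]]]]]].
pose S := @segment K 'rV[K]_3; pose s := @segment K K^o.
exists (fun t => config (iota 1 9) (pascal_vectors (S v1 w1 t) (S v2 w2 t) (S v3 w3 t)
  (S v7 w7 t) (S v8 w8 t) (s a a' t) (s b b' t) (s k4 l4 t) (s k5 l5 t) (s k6 l6 t))).
split.
- pose v9 t := s a a' t *: S v7 w7 t + s b b' t *: S v8 w8 t.
  apply: (@curve_config K (iota 1 9) [:: S v1 w1; S v2 w2; S v3 w3;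
    fun t => s k4 l4 t *: cross (cross (S v2 w2 t) (S v7 w7 t)) (cross (S v3 w3 t) (S v8 w8 t));
    fun t => s k5 l5 t *: cross (cross (S v1 w1 t) (S v7 w7 t)) (cross (S v3 w3 t) (v9 t));
    fun t => s k6 l6 t *: cross (cross (S v1 w1 t) (S v8 w8 t)) (cross (S v2 w2 t) (v9 t));
    S v7 w7; S v8 w8; v9]).
  by rewrite /= /v9 /S /s; do !split; segment_fun.
- by rewrite /S /s !segment0.
- by rewrite /S /s !segment1.
- move=> t; exists (S v1 w1 t), (S v2 w2 t), (S v3 w3 t), (S v7 w7 t), (S v8 w8 t).
  by exists (s a a' t), (s b b' t), (s k4 l4 t), (s k5 l5 t), (s k6 l6 t).
Qed.

Lemma pascal_family_sub M : dependence M pascal_dependence ->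
  pascal_family `<=` circuit_variety K M.
Proof.
move=> hD g [v1 [v2 [v3 [v7 [v8 [a [b [k4 [k5 [k6 ->]]]]]]]]]].
apply/(circuit_varietyE _ hD) => l _ /orP[l3|].
  by apply: dependent_seq_size; rewrite size_map.
rewrite !in_cons in_nil orbF; do 6?case/predU1P=> [->|]; try move/eqP->;
  by rewrite /= !vec_config //=; apply/eqP; det_ring.
Qed.

(** The nondegeneracy is just what makes the three intersections nonzero and [v9] a combination, so
    generic hexagons qualify as well as realizations of M. *)
Lemma pascal_familyP g :
  [/\ det3 (vec g 1) (vec g 8) (vec g 6) = 0, det3 (vec g 1) (vec g 7) (vec g 5) = 0,
      det3 (vec g 2) (vec g 7) (vec g 4) = 0 & det3 (vec g 2) (vec g 9) (vec g 6) = 0] ->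
  [/\ det3 (vec g 3) (vec g 8) (vec g 4) = 0, det3 (vec g 3) (vec g 9) (vec g 5) = 0 &
      det3 (vec g 7) (vec g 8) (vec g 9) = 0] ->
  [/\ det3 (vec g 1) (vec g 8) (vec g 9) != 0, det3 (vec g 1) (vec g 7) (vec g 9) != 0 &
      det3 (vec g 2) (vec g 7) (vec g 8) != 0] ->
  [/\ cross (vec g 7) (vec g 8) != 0, cross (vec g 2) (vec g 9) != 0,
      cross (vec g 3) (vec g 9) != 0 &
      cross (vec g 3) (vec g 8) != 0] ->
  pascal_family g.
Proof.
move=> [h186 h175 h274 h296] [h384 h395 h789] [n189 n179 n278] [n78 n29 n39 n38].
have [a [b e9]] := span2 n78 h789.
have [k4 e4] := meetP h274 h384 (meet_neq0 n278 n38).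
have [k5 e5] := meetP h175 h395 (meet_neq0 n179 n39).
have [k6 e6] := meetP h186 h296 (meet_neq0 n189 n29).
exists (vec g 1), (vec g 2), (vec g 3), (vec g 7), (vec g 8), a, b, k4, k5, k6.
rewrite -[LHS](@config_vec _ (iota 1 9)) //; congr config.
by rewrite /pascal_vectors -e9 -e4 -e5 -e6.
Qed.

(** Rank at most two written as a factorization, since the two factors can be moved along segments
    freely. *)
Definition line_family : set 'M[K]_(9, 3) :=
  [set g | exists (A : 'M[K]_(9, 2)) (B : 'M[K]_(2, 3)), g = A *m B].

Lemma line_family_joined g g' : line_family g -> line_family g' ->
  exists c, [/\ curve c, c 0 = g, c 1 = g' & forall t, line_family (c t)].
Proof.
move=> [A [B ->]] [A' [B' ->]].
exists (fun t => segment A A' t *m segment B B' t); split.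
- by apply: (rc_mxmul (polyf_ring K)); apply: curve_segment.
- by rewrite !segment0.
- by rewrite !segment1.
- by move=> t; exists (segment A A' t), (segment B B' t).
Qed.

Lemma row_mulmx2 m (A : 'M[K]_(m, 2)) (B : 'M[K]_(2, 3)) i :
  row i (A *m B) = A i 0 *: row 0 B + A i 1 *: row 1 B.
Proof.
rewrite row_mul mulmx_sum_row !big_ord_recl big_ord0 addr0 !mxE.
by have -> : lift ord0 ord0 = 1 :> 'I_2 by apply: val_inj.
Qed.

Lemma line_family_sub N : dependence N line_dependence ->
  line_family `<=` circuit_variety K N.
Proof.
move=> hD g [A [B ->]]; apply/(circuit_varietyE _ hD) => l _.
case: l => [|x [|y [|z [|w l]]]] //= _.
rewrite /vec !row_mulmx2; apply/eqP; move: (row _ _) (row _ _) => a b.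
by move: (A _ _) (A _ _) (A _ _) (A _ _) (A _ _) (A _ _) => *; det_ring.
Qed.

Lemma line_familyP g (a b : 'rV[K]_3) :
  (forall i, exists k l, row i g = k *: a + l *: b) -> line_family g.
Proof.
move=> /choice[k /choice[l h]].
exists (\matrix_(i, j) if j == 0 then k i else l i), (\matrix_(i < 2) if i == 0 then a else b).
by apply/row_matrixP => i; rewrite row_mulmx2 !rowK !mxE /= h.
Qed.

Lemma line_family_realizations N : dependence N line_dependence ->
  realization_space K N `<=` line_family.
Proof.
move=> hD g hg; apply: (@line_familyP g (vec g 1) (vec g 2)) => i.
have n12 : cross (vec g 1) (vec g 2) != 0.
  by have /negbT := realization_dependent hD hg (isT : uniq [:: 1; 2]%N) isT.
suff h k : k \in iota 1 9 -> det3 (vec g 1) (vec g 2) (vec g k) = 0.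
  by apply: span2; rewrite // -[i in row i]point_succ h ?succ_label.
move=> hk; have [->|k1] := eqVneq k 1%N; first by det_ring.
have [->|k2] := eqVneq k 2%N; first by det_ring.
have u : uniq [:: 1; 2; k]%N by rewrite /= !inE !(eq_sym _ k) (negPf k1) (negPf k2).
have al : all (mem (iota 1 9)) [:: 1; 2; k]%N by apply/and4P.
have /= := realization_dependent hD hg u al.
have -> : line_dependence (sort_labels [:: 1; 2; k]%N).
  by rewrite /line_dependence -(perm_size (perm_sort_labels u al)).
by move/eqP.
Qed.

Lemma planar_config ls s : planar s -> line_family (config ls s).
Proof.
by move=> [a [b h]]; apply: (@line_familyP _ a b) => i; rewrite rowK.
Qed.

Section QuadFamily.
Variables (i q0 q1 q2 q3 p0 p1 p2 p3 : nat).
Let ls := [:: i; q0; q1; q2; q3; p0; p1; p2; p3].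
Let lines := [:: [:: q0; q1; p0]; [:: q1; q2; p1]; [:: q2; q3; p2]; [:: q3; q0; p3]].
Let sides := [:: [:: q0; q1]; [:: q1; q2]; [:: q2; q3]; [:: q3; q0]].

(* the lines of M avoiding i form the quadrilateral q0 q1 q2 q3, with a further
   point p on each side *)
Definition quad_labels : bool :=
  [&& perm_eq ls (iota 1 9),
      all (fun s => uniq s && all (mem (iota 1 9)) s) (lines ++ sides),
      all (fun s => (i \in s) || has (perm_eq s) lines) pascal_triples,
      all (fun s => sort_labels s \in pascal_triples) lines
    & all (fun s => ~~ loop_dependence i (sort_labels s)) sides].

Definition quad_family : set 'M[K]_(9, 3) :=
  [set g | exists z0 z1 z2 z3 y0 y1 y2 y3,
     [/\ in_span z0 z1 y0, in_span z1 z2 y1, in_span z2 z3 y2 & in_span z3 z0 y3]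
     /\ g = config ls [:: 0; z0; z1; z2; z3; y0; y1; y2; y3]].

Lemma quad_family_joined g g' : quad_family g -> quad_family g' ->
  exists c, [/\ curve c, c 0 = g, c 1 = g' & forall t, quad_family (c t)].
Proof.
move=> [z0 [z1 [z2 [z3 [y0 [y1 [y2 [y3 [[[a0 [b0 e0]] [a1 [b1 e1]]]]]]]]]]]].
move=> [a2 [b2 e2]] [a3 [b3 e3]] eg.
move=> [z0' [z1' [z2' [z3' [y0' [y1' [y2' [y3' [[[a0' [b0' e0']] [a1' [b1' e1']]]]]]]]]]]].
move=> [a2' [b2' e2']] [a3' [b3' e3']] eg'.
pose S := @segment K 'rV[K]_3; pose s := @segment K K^o.
pose Z0 := S z0 z0'; pose Z1 := S z1 z1'; pose Z2 := S z2 z2'; pose Z3 := S z3 z3'.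
pose Y0 t := s a0 a0' t *: Z0 t + s b0 b0' t *: Z1 t.
pose Y1 t := s a1 a1' t *: Z1 t + s b1 b1' t *: Z2 t.
pose Y2 t := s a2 a2' t *: Z2 t + s b2 b2' t *: Z3 t.
pose Y3 t := s a3 a3' t *: Z3 t + s b3 b3' t *: Z0 t.
exists (fun t => config ls [:: 0; Z0 t; Z1 t; Z2 t; Z3 t; Y0 t; Y1 t; Y2 t; Y3 t]).
split.
- apply: (@curve_config K ls [:: fun=> 0; Z0; Z1; Z2; Z3; Y0; Y1; Y2; Y3]).
  by rewrite /= /Y0 /Y1 /Y2 /Y3 /Z0 /Z1 /Z2 /Z3 /S /s; do !split; segment_fun.
- by rewrite eg e0 e1 e2 e3 /Y0 /Y1 /Y2 /Y3 /Z0 /Z1 /Z2 /Z3 /S /s !segment0.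
- by rewrite eg' e0' e1' e2' e3' /Y0 /Y1 /Y2 /Y3 /Z0 /Z1 /Z2 /Z3 /S /s !segment1.
- move=> t; exists (Z0 t), (Z1 t), (Z2 t), (Z3 t), (Y0 t), (Y1 t), (Y2 t), (Y3 t).
  split=> //; split.
  + by exists (s a0 a0' t), (s b0 b0' t). + by exists (s a1 a1' t), (s b1 b1' t).
  + by exists (s a2 a2' t), (s b2 b2' t). + by exists (s a3 a3' t), (s b3 b3' t).
Qed.

Hypothesis hq : quad_labels.

Let perm_ls : perm_eq ls (iota 1 9). Proof. by case/andP: hq. Qed.
Let uniq_ls : uniq ls. Proof. by rewrite (perm_uniq perm_ls) iota_uniq. Qed.
Let sub_ls : all (mem ls) (iota 1 9).
Proof. by apply/allP => k; rewrite -(perm_mem perm_ls). Qed.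
Let vec_ls (s : seq 'rV[K]_3) j : (j < 9)%N -> vec (config ls s) (nth 0%N ls j) = nth 0 s j.
Proof.
move=> j9; rewrite vec_config -?(perm_mem perm_ls) ?mem_nth //.
by rewrite index_uniq.
Qed.

Lemma loop_label : i \in iota 1 9.
Proof. by rewrite -(perm_mem perm_ls) mem_head. Qed.

Lemma quad_config_in g : vec g i = 0 ->
  [/\ in_span (vec g q0) (vec g q1) (vec g p0), in_span (vec g q1) (vec g q2) (vec g p1),
      in_span (vec g q2) (vec g q3) (vec g p2) & in_span (vec g q3) (vec g q0) (vec g p3)] ->
  quad_family g.
Proof.
move=> gi h; exists (vec g q0), (vec g q1), (vec g q2), (vec g q3).
exists (vec g p0), (vec g p1), (vec g p2), (vec g p3); split=> //.
by rewrite -[LHS](config_vec g sub_ls) /= gi.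
Qed.

Let wf s : s \in lines ++ sides -> uniq s && all (mem (iota 1 9)) s.
Proof. by case/and5P: hq => _ /allP h _ _ _; apply: h. Qed.

Lemma quad_family_sub N : dependence N (loop_dependence i) ->
  quad_family `<=` circuit_variety K N.
Proof.
move=> hD g [z0 [z1 [z2 [z3 [y0 [y1 [y2 [y3 [[s0 s1 s2 s3] ->]]]]]]]]].
set s := [:: 0; _; _; _; _; _; _; _; _].
have vi := vec_ls s (isT : (0 < 9)%N).
have [v0 v1] := (vec_ls s (isT : (1 < 9)%N), vec_ls s (isT : (2 < 9)%N)).
have [v2 v3] := (vec_ls s (isT : (3 < 9)%N), vec_ls s (isT : (4 < 9)%N)).
have [w0 w1] := (vec_ls s (isT : (5 < 9)%N), vec_ls s (isT : (6 < 9)%N)).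
have [w2 w3] := (vec_ls s (isT : (7 < 9)%N), vec_ls s (isT : (8 < 9)%N)).
rewrite /= in vi v0 v1 v2 v3 w0 w1 w2 w3.
apply/(circuit_varietyE _ hD) => l _ /orP[il|/orP[l3|lt]].
- by apply: dependent_seq0; apply/mapP; exists i.
- by apply: dependent_seq_size; rewrite size_map.
have [il|il] := boolP (i \in l); first by apply: dependent_seq0; apply/mapP; exists i.
case/and5P: hq => _ _ /allP/(_ l lt); rewrite (negPf il) => /hasP[m hm lm] _ _.
rewrite (dependent_seq_perm (perm_map _ lm)).
by move: hm; rewrite !inE => /or4P[] /eqP->; rewrite /= ?(v0, v1, v2, v3, w0, w1, w2, w3);
  apply/eqP/in_span_det3.
Qed.

Lemma realization_loop N g : dependence N (loop_dependence i) ->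
  realization_space K N g -> vec g i = 0.
Proof.
move=> hD hg; have al : all (mem (iota 1 9)) [:: i] by rewrite /= andbT loop_label.
have /= := realization_dependent hD hg (isT : uniq [:: i]) al.
rewrite /loop_dependence mem_filter inE eqxx loop_label /=; exact: eqP.
Qed.

Lemma quad_family_realizations N : dependence N (loop_dependence i) ->
  realization_space K N `<=` quad_family.
Proof.
move=> hD g hg; apply: quad_config_in; first exact: realization_loop hg.
have side a b p : [:: a; b; p] \in lines -> [:: a; b] \in sides ->
    in_span (vec g a) (vec g b) (vec g p).
  move=> hl hs.
  have /andP[ul al] : uniq [:: a; b; p] && all (mem (iota 1 9)) [:: a; b; p].
    by apply: wf; rewrite mem_cat hl.
  have /andP[us as_] : uniq [:: a; b] && all (mem (iota 1 9)) [:: a; b].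
    by apply: wf; rewrite mem_cat hs orbT.
  apply: span2.
    have /= := realization_dependent hD hg us as_.
    by case/and5P: hq => _ _ _ _ /allP/(_ _ hs)/negPf-> /negbT.
  have /= := realization_dependent hD hg ul al.
  case/and5P: hq => _ _ _ /allP/(_ _ hl) hm _.
  by rewrite /loop_dependence /pascal_dependence hm !orbT => /eqP.
by split; apply: side; rewrite !inE eqxx ?orbT.
Qed.

Lemma quad_circuit_variety M g : dependence M pascal_dependence ->
  circuit_variety K M g ->
  quad (vec g q0) (vec g q1) (vec g q2) (vec g q3)
       (vec g p0) (vec g p1) (vec g p2) (vec g p3).
Proof.
move=> hD hg.
have line a b p : [:: a; b; p] \in lines -> det3 (vec g a) (vec g b) (vec g p) = 0.
  move=> hl.
  have /andP[ul al] : uniq [:: a; b; p] && all (mem (iota 1 9)) [:: a; b; p].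
    by apply: wf; rewrite mem_cat hl.
  have /= h := circuit_variety_dependent hD hg ul al; apply/eqP/h.
  case/and5P: hq => _ _ _ /allP/(_ _ hl) hm _.
  by rewrite /pascal_dependence hm orbT.
by split; apply: line; rewrite !inE eqxx ?orbT.
Qed.

Lemma loop_sub_matroid_variety M N g : dependence M pascal_dependence ->
  dependence N (loop_dependence i) -> realization_space K N !=set0 ->
  circuit_variety K M g -> vec g i = 0 -> matroid_variety K N g.
Proof.
move=> hM hN nN hg gi.
have sW := sub_matroid_variety nN (quad_family_realizations hN)
  (quad_family_sub hN) quad_family_joined.
pose Q s := matroid_variety K N (config ls (0 :: s)).
have Qc : curve_closed Q.
  apply: (@curve_closed_matrix K 9 _ (fun s => config ls (0 :: s))).
    exact: zariski_closure_closed.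
  move=> fs cfs; apply: (@curve_config K ls ((fun=> 0) :: fs)).
  by split=> //; poly_fun.
have HQ : contains_quads Q.
  move=> z0 z1 z2 z3 y0 y1 y2 y3 s0 s1 s2 s3; apply: sW.
  by exists z0, z1, z2, z3, y0, y1, y2, y3.
have := quad_all Qc HQ (quad_circuit_variety hM hg).
by rewrite /Q -gi; have /= -> := config_vec g sub_ls.
Qed.

End QuadFamily.
End Parametrizations.

(** * Equations that hold on the matroid varieties *)

Section VanishingOnRealizations.
Variable K : numFieldType.
Implicit Types (g : 'M[K]_(9, 3)) (N M : matroid 'I_9).

Lemma rc_vec k : on_entries (@polymx K 9 3) (fun g => vec g k).
Proof. by move=> i j; under eq_fun do rewrite mxE; apply: polymx_entries. Qed.

Lemma closure_vanish (G : set 'M[K]_(9, 3)) F :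
  polymx F -> (forall g, G g -> F g = 0) -> forall g, zariski_closure G g -> F g = 0.
Proof. by move=> pF h; apply: zariski_closure_sub; [apply: zariski_closed_zero|]. Qed.

Lemma matroid_variety_loop N i g : (forall g', realization_space K N g' -> vec g' i = 0) ->
  matroid_variety K N g -> vec g i = 0.
Proof.
move=> h hg; apply/rowP => j; rewrite [RHS]mxE.
apply: (closure_vanish (F := fun g => vec g i 0 j)) hg; first exact: rc_vec.
by move=> g' /h ->; rewrite mxE.
Qed.

Lemma uniform_variety_det3 a b c g : matroid_variety K (uniform 'I_9 2) g ->
  uniq [:: a; b; c] -> all (mem (iota 1 9)) [:: a; b; c] ->
  det3 (vec g a) (vec g b) (vec g c) = 0.
Proof.
move=> hg u al; move: g hg; apply: closure_vanish.
  by apply: (rc_det3 (@polymx_ring K 9 3)); apply: rc_vec.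
move=> g' /realization_dependent/(_ u al) h; have /= := h _ dependence_uniform.
by rewrite /line_dependence -(perm_size (perm_sort_labels u al)) => /eqP.
Qed.

Definition diagonal_point g (a b c d : nat) : 'rV[K]_3 :=
  cross (cross (vec g a) (vec g b)) (cross (vec g c) (vec g d)).

Section OfPascal.
Variable M : matroid 'I_9.
Hypothesis hM : dependence M pascal_dependence.

Lemma pascal_realization_det3 g a b c : realization_space K M g ->
  uniq [:: a; b; c] -> all (mem (iota 1 9)) [:: a; b; c] ->
  (det3 (vec g a) (vec g b) (vec g c) == 0) = (sort_labels [:: a; b; c] \in pascal_triples).
Proof.
move=> hg u al; have /= -> := realization_dependent hM hg u al.
by rewrite /pascal_dependence -(perm_size (perm_sort_labels u al)).
Qed.

Lemma pascal_realization_cross g a b : realization_space K M g ->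
  uniq [:: a; b] -> all (mem (iota 1 9)) [:: a; b] -> cross (vec g a) (vec g b) != 0.
Proof.
move=> hg u al; have /= -> := realization_dependent hM hg u al.
rewrite /pascal_dependence negb_or -(perm_size (perm_sort_labels u al)) /=.
apply/negP => /pascal_triples_subseq/andP[_].
by rewrite -(perm_size (perm_sort_labels u al)).
Qed.

(* Up to scalars the three arguments are the vectors 7, 8, 9; by Pascal's theorem
   the equation says that the points 1, ..., 6 lie on a conic. *)
Lemma pascal_variety_conic g : matroid_variety K M g ->
  det3 (diagonal_point g 1 5 2 4) (diagonal_point g 1 6 3 4) (diagonal_point g 2 6 3 5) = 0.
Proof.
move: g; apply: closure_vanish.
  rewrite /diagonal_point.
  by apply: (rc_det3 (@polymx_ring K 9 3)); do 2!apply: (rc_cross (@polymx_ring K 9 3));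
     apply: rc_vec.
move=> g hg; have D a b c := pascal_realization_det3 (a := a) (b := b) (c := c) hg.
have diag a b c d x : x \in iota 1 9 ->
    det3 (vec g a) (vec g b) (vec g x) = 0 -> det3 (vec g c) (vec g d) (vec g x) = 0 ->
    diagonal_point g a b c d = 0 \/
    exists2 k, k != 0 & vec g x = k *: diagonal_point g a b c d.
  (* Splitting off a zero intersection, for which the determinant vanishes at once, avoids proving
     that the two lines are distinct. *)
  move=> hx h1 h2; have [e|n] := eqVneq (diagonal_point g a b c d) 0; [by left|right].
  have [k e] := meetP h1 h2 n; exists k => //; apply/eqP => k0.
  have al : all (mem (iota 1 9)) [:: x] by rewrite /= hx.
  have /= := realization_dependent hM hg (isT : uniq [:: x]) al.
  rewrite e k0 scale0r eqxx => /esym; rewrite /pascal_dependence.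
  rewrite -(perm_size (perm_sort_labels (isT : uniq [:: x]) al)) /=.
  move/pascal_triples_subseq/andP => [_].
  by rewrite -(perm_size (perm_sort_labels (isT : uniq [:: x]) al)).
have d0 (x y : 'rV[K]_3) : [/\ det3 0 x y = 0, det3 x 0 y = 0 & det3 x y 0 = 0].
  by split; det_ring.
have [||-> |[k7 k7n e7]] // := diag 1%N 5%N 2%N 4%N 7%N isT; try by apply/eqP; rewrite D.
  by have [->] := d0 (diagonal_point g 1 6 3 4) (diagonal_point g 2 6 3 5).
have [||-> |[k8 k8n e8]] // := diag 1%N 6%N 3%N 4%N 8%N isT; try by apply/eqP; rewrite D.
  by have [_ ->] := d0 (diagonal_point g 1 5 2 4) (diagonal_point g 2 6 3 5).
have [||-> |[k9 k9n e9]] // := diag 2%N 6%N 3%N 5%N 9%N isT; try by apply/eqP; rewrite D.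
  by have [_ _ ->] := d0 (diagonal_point g 1 5 2 4) (diagonal_point g 1 6 3 4).
have /eqP : det3 (vec g 7) (vec g 8) (vec g 9) == 0 by rewrite D.
rewrite e7 e8 e9 det3_scale.
by move/eqP; rewrite !mulf_eq0 (negPf k7n) (negPf k8n) (negPf k9n) => /eqP.
Qed.

(* With l = det3 8 9, every side x y through c gives l x * det3 v y c = l y * det3 v x c,
   and l x cancels around the hexagon. The relation still makes sense, and fails in
   general, when all the points are collinear. *)
Lemma pascal_variety_menelaus (v : 'rV[K]_3) g : matroid_variety K M g ->
  det3 v (vec g 6) (vec g 8) * det3 v (vec g 2) (vec g 9) * det3 v (vec g 4) (vec g 7) *
  det3 v (vec g 3) (vec g 8) * det3 v (vec g 5) (vec g 9) * det3 v (vec g 1) (vec g 7) -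
  det3 v (vec g 1) (vec g 8) * det3 v (vec g 6) (vec g 9) * det3 v (vec g 2) (vec g 7) *
  det3 v (vec g 4) (vec g 8) * det3 v (vec g 3) (vec g 9) * det3 v (vec g 5) (vec g 7) = 0.
Proof.
move: g; apply: closure_vanish.
  apply: (rc_sub (@polymx_ring K 9 3)); do 6?[apply: (rc_mul (@polymx_ring K 9 3))];
  by apply: (rc_det3 (@polymx_ring K 9 3)); [apply: (rc_mxcst (@polymx_ring K 9 3))| |];
     apply: rc_vec.
move=> g hg; have D a b c := pascal_realization_det3 (a := a) (b := b) (c := c) hg.
pose l x := det3 (vec g 8) (vec g 9) (vec g x).
have side x y c : det3 (vec g x) (vec g y) (vec g c) == 0 -> l c = 0 ->
    l x * det3 v (vec g y) (vec g c) = l y * det3 v (vec g x) (vec g c).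
  move=> /eqP h lc; apply/eqP; rewrite -subr_eq0; apply/eqP.
  (* A Pluecker relation: [l] applied to the linear relation between the four vectors [v], [x], [y],
     [c]. *)
  have -> : l x * det3 v (vec g y) (vec g c) - l y * det3 v (vec g x) (vec g c)
    = det3 (vec g 8) (vec g 9) v * det3 (vec g x) (vec g y) (vec g c)
      - l c * det3 v (vec g x) (vec g y).
    by rewrite /l; move: (vec g) => V; det_ring.
  by rewrite h lc mulr0 mul0r subrr.
have l8 : l 8%N = 0 by rewrite /l; det_ring.
have l9 : l 9%N = 0 by rewrite /l; det_ring.
have l7 : l 7%N = 0 by apply/eqP; rewrite /l D.
have n x : x \in iota 1 6 -> l x != 0.
  by move=> hx; rewrite /l D; move: x hx; apply/allP; vm_compute.
have s0 := side 1%N 6%N 8%N; have s1 := side 6%N 2%N 9%N; have s2 := side 2%N 4%N 7%N.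
have s3 := side 4%N 3%N 8%N; have s4 := side 3%N 5%N 9%N; have s5 := side 5%N 1%N 7%N.
rewrite !D // in s0 s1 s2 s3 s4 s5.
move: (s0 isT l8) (s1 isT l9) (s2 isT l7) (s3 isT l8) (s4 isT l9) (s5 isT l7).
have : l 1%N * l 2%N * l 3%N * l 4%N * l 5%N * l 6%N != 0 by rewrite !mulf_neq0 ?n.
move: (l 1%N) (l 2%N) (l 3%N) (l 4%N) (l 5%N) (l 6%N) => a1 a2 a3 a4 a5 a6 nl.
move: (det3 v (vec g 6) (vec g 8)) (det3 v (vec g 2) (vec g 9)) (det3 v (vec g 4) (vec g 7)).
move: (det3 v (vec g 3) (vec g 8)) (det3 v (vec g 5) (vec g 9)) (det3 v (vec g 1) (vec g 7)).
move=> q3 q4 q5 q0 q1 q2 e0 e1 e2 e3 e4 e5; apply: (mulfI nl).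
rewrite mulr0 mulrBr; apply/eqP; rewrite subr_eq0; apply/eqP.
transitivity ((a1 * q0) * (a6 * q1) * (a2 * q2) * (a4 * q3) * (a3 * q4) * (a5 * q5)); first by ring.
by rewrite e0 e1 e2 e3 e4 e5; ring.
Qed.

End OfPascal.
End VanishingOnRealizations.

(** * The components *)

Lemma quad_labels7 : quad_labels 7 8 6 9 3 1 2 5 4.
Proof. by vm_compute. Qed.

Lemma quad_labels8 : quad_labels 8 7 2 9 5 4 6 3 1.
Proof. by vm_compute. Qed.

Lemma quad_labels9 : quad_labels 9 8 1 7 4 6 5 2 3.
Proof. by vm_compute. Qed.

Section Decomposition.
Variables (K : numFieldType) (M : matroid 'I_9).
Hypothesis pM : is_pascal M.
Let hM := dependence_pascal pM.

(** Points 1, 2, 3 are the basis, 9 is twice 7 plus 8, and 4, 5, 6 are the intersections of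
    [pascal_vectors]. *)
Definition pascal_point : seq (int * int * int) :=
  [:: (1, 0, 0); (0, 1, 0); (0, 0, 1); (1, -1, -1); (-2, -2, 1); (3, 1, -1);
      (-1, -2, 1); (-1, 1, -1); (-3, -3, 1)].
(** The slopes are the labels, except 10 for the point 1: slope 1 would give both products of the
    Menelaus relation the value 5040. *)
Definition line_point : seq (int * int * int) :=
  [:: (1, 10, 0); (1, 2, 0); (1, 3, 0); (1, 4, 0); (1, 5, 0); (1, 6, 0);
      (1, 7, 0); (1, 8, 0); (1, 9, 0)].
(** In each of the loop configurations the vertices of the quadrilateral are the three basis vectors
    and a vector without zero coordinates; the other points are combinations of the ends of their
    sides. *)
Definition loop7_point : seq (int * int * int) :=
  [:: (-1, 1, 0); (0, 1, 2); (1, 1, -1); (2, 1, -1); (1, 1, 1); (0, 1, 0);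
      (0, 0, 0); (1, 0, 0); (0, 0, 1)].
Definition loop8_point : seq (int * int * int) :=
  [:: (1, 1, 1); (0, 1, 0); (-1, 1, 2); (2, 1, 0); (-1, 1, 1); (0, -1, 1);
      (1, 0, 0); (0, 0, 0); (0, 0, 1)].
Definition loop9_point : seq (int * int * int) :=
  [:: (0, 1, 0); (1, 1, 2); (1, -1, -1); (-1, -1, -1); (0, 1, -1); (2, -1, 0);
      (0, 0, 1); (1, 0, 0); (0, 0, 0)].

Let h7 := dependence_loop hM (isT : 7%N \in iota 1 9).
Let h8 := dependence_loop hM (isT : 8%N \in iota 1 9).
Let h9 := dependence_loop hM (isT : 9%N \in iota 1 9).

Lemma pascal_realizable : realization_space K M (configZ K pascal_point).
Proof. by apply: (realization_configZ _ hM); vm_compute. Qed.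

Lemma uniform_realizable : realization_space K (uniform 'I_9 2) (configZ K line_point).
Proof. by apply: (realization_configZ _ dependence_uniform); vm_compute. Qed.

Lemma loop7_realizable : realization_space K (make_loop M (point 7)) (configZ K loop7_point).
Proof. by apply: (realization_configZ _ h7); vm_compute. Qed.

Lemma loop8_realizable : realization_space K (make_loop M (point 8)) (configZ K loop8_point).
Proof. by apply: (realization_configZ _ h8); vm_compute. Qed.

Lemma loop9_realizable : realization_space K (make_loop M (point 9)) (configZ K loop9_point).
Proof. by apply: (realization_configZ _ h9); vm_compute. Qed.

Let n0 N e : realization_space K N (configZ K e) -> realization_space K N !=set0.
Proof. by exists (configZ K e). Qed.

Lemma pascal_realizations : realization_space K M `<=` @pascal_family K.
Proof.
move=> g hg; have D a b c := pascal_realization_det3 hM (a := a) (b := b) (c := c) hg.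
have E a b := pascal_realization_cross hM (a := a) (b := b) hg.
by apply: pascal_familyP; split; first [by apply/eqP; rewrite D|by rewrite D|by apply: E].
Qed.

Lemma pascal_irreducible : irreducible (matroid_variety K M).
Proof.
exact: (matroid_variety_irreducible (n0 pascal_realizable) pascal_realizations
  (pascal_family_sub hM) (@pascal_family_joined K)).
Qed.

Lemma pascal_family_variety : @pascal_family K `<=` matroid_variety K M.
Proof.
exact: (sub_matroid_variety (n0 pascal_realizable) pascal_realizations
  (pascal_family_sub hM) (@pascal_family_joined K)).
Qed.

Lemma uniform_irreducible : irreducible (matroid_variety K (uniform 'I_9 2)).
Proof.
exact: (matroid_variety_irreducible (n0 uniform_realizable)
  (line_family_realizations dependence_uniform)
  (line_family_sub dependence_uniform) (@line_family_joined K)).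
Qed.

Lemma line_family_variety : @line_family K `<=` matroid_variety K (uniform 'I_9 2).
Proof.
exact: (sub_matroid_variety (n0 uniform_realizable)
  (line_family_realizations dependence_uniform)
  (line_family_sub dependence_uniform) (@line_family_joined K)).
Qed.

Lemma loop_irreducible i q0 q1 q2 q3 p0 p1 p2 p3 N :
  quad_labels i q0 q1 q2 q3 p0 p1 p2 p3 -> dependence N (loop_dependence i) ->
  realization_space K N !=set0 -> irreducible (matroid_variety K N).
Proof.
move=> hq hN nN.
exact: (matroid_variety_irreducible nN (quad_family_realizations hq hN)
  (quad_family_sub hq hN) (@quad_family_joined K _ _ _ _ _ _ _ _ _)).
Qed.

Lemma pascal_cover g : circuit_variety K M g ->
  vec g 7 != 0 -> vec g 8 != 0 -> vec g 9 != 0 ->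
  (matroid_variety K M `|` matroid_variety K (uniform 'I_9 2)) g.
Proof.
move=> hg g7 g8 g9; set Z := _ `|` _.
pose ls := [:: 1; 6; 2; 4; 3; 5; 8; 9; 7]%N.
have line a b c : uniq [:: a; b; c] && all (mem (iota 1 9)) [:: a; b; c] ->
    sort_labels [:: a; b; c] \in pascal_triples -> det3 (vec g a) (vec g b) (vec g c) = 0.
  move=> /andP[u al] hs; have /= h := circuit_variety_dependent hM hg u al.
  by apply/eqP/h; rewrite /pascal_dependence hs orbT.
pose Q s := Z (config ls s).
have Qc : curve_closed Q.
  apply: (@curve_closed_matrix K 9 Z (config ls)); last exact: curve_config.
  by apply: zariski_closedU; apply: zariski_closure_closed.
have hx : hexagon (vec g 1) (vec g 6) (vec g 2) (vec g 4) (vec g 3) (vec g 5)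
    (vec g 8) (vec g 9) (vec g 7).
  by split; [apply: line..|split; apply: line].
have HQ : contains_hexagons Q; last first.
  have := hexagon_nonzero Qc HQ g8 g9 g7 hx; rewrite /Q.
  by have /= -> := config_vec g (isT : all (mem ls) (iota 1 9)).
move=> x0 x1 x2 x3 x4 x5 A B C [|[pl _]]; last first.
  by rewrite /Q /Z; right; apply: line_family_variety; apply: planar_config.
move=> [[d d0 d1 d2 [d3 d4 d5]] AB BC CA /and5P[l0 _ l2 _ /and3P[l4 _ _]]].
have off x : det3 A B x != 0 -> cross x A != 0 /\ cross x B != 0.
  have B0 : B != 0 by apply: contraNneq AB => ->; rewrite crossv0.
  have A0 : A != 0 by apply: contraNneq AB => ->; rewrite cross0v.
  by move=> lx; split; apply: contraNneq lx;
    [move=> /(parallel A0)|move=> /(parallel B0)] => -[k ->]; apply/eqP; det_ring.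
have [_ x2B] := off _ l2; have [x4A x4B] := off _ l4.
left; apply: pascal_family_variety; apply: pascal_familyP; rewrite !vec_config //=; split=> //.

- by rewrite det3_swapr d0 oppr0.
- by rewrite -d5; det_ring.
- by rewrite det3_swapr d2 oppr0.
- by rewrite -d1; det_ring.
- by rewrite -d3; det_ring.
- by rewrite det3_swapr d4 oppr0.
- by rewrite -d; det_ring.
- by have -> : det3 x0 A B = det3 A B x0 by det_ring.
- have -> : det3 x0 C B = - det3 B C x0 by det_ring.
  by rewrite oppr_eq0 (det3_plane _ d AB BC).
- have -> : det3 x2 C A = det3 C A x2 by det_ring.
  by rewrite (@det3_plane _ B C A) ?(det3_plane _ d AB BC) // -d; det_ring.
Qed.

Lemma pascal_circuit_variety_closed : zariski_closed (circuit_variety K M).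
Proof.
pose F s (g : 'M[K]_(9, 3)) : K := if s \in pascal_triples then
  det3 (vec g (nth 0%N s 0)) (vec g (nth 0%N s 1)) (vec g (nth 0%N s 2)) else 0.
suff -> : circuit_variety K M = [set g | forall s, F s g = 0].
  apply: (@zariski_closedI K 9 3 _ (fun s => [set g | F s g = 0])) => s.
  apply: zariski_closed_zero; rewrite /F; case: (s \in _).
    by apply: (rc_det3 (@polymx_ring K 9 3)); apply: rc_vec.
  exact: (rc_cst (@polymx_ring K 9 3)).
have triple s g : s \in pascal_triples ->
    (F s g == 0) = dependent_seq [seq vec g k | k <- s].
  move=> hs; rewrite /F hs; have /andP[_] := pascal_triples_subseq hs.
  by case: s {hs} => [|a [|b [|c []]]].
apply/seteqP; split=> g.
  move=> /(circuit_varietyE _ hM) h s; have [hs|hs] := boolP (s \in pascal_triples); last first.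
    by rewrite /F (negPf hs).
  apply/eqP; rewrite triple // h ?/pascal_dependence ?hs ?orbT //.
  by have /andP[] := pascal_triples_subseq hs.
move=> h; apply/(circuit_varietyE _ hM) => l _ /orP[l3|hl].
  by apply: dependent_seq_size; rewrite size_map.
by rewrite -triple // h.
Qed.

Lemma matroid_variety_sub N D : dependence N D ->
  (forall l, pascal_dependence l -> D l) ->
  matroid_variety K N `<=` circuit_variety K M.
Proof.
move=> hN MN; apply: zariski_closure_sub; first exact: pascal_circuit_variety_closed.
by move=> g hg S; rewrite hM => /MN; rewrite -hN => /(hg S).
Qed.

Let components := [:: matroid_variety K M; matroid_variety K (uniform 'I_9 2);
  matroid_variety K (make_loop M (point 7)); matroid_variety K (make_loop M (point 8));
  matroid_variety K (make_loop M (point 9))].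

Lemma pascal_circuit_varietyE :
  circuit_variety K M = \big[setU/set0]_(Z <- components) Z.
Proof.
rewrite 5!big_cons big_nil; apply/seteqP; split=> g.
  move=> hg; have [g7|g7] := eqVneq (vec g 7) 0.
    by right; right; left;
    apply: (loop_sub_matroid_variety quad_labels7 hM h7 (n0 loop7_realizable)).
  have [g8|g8] := eqVneq (vec g 8) 0.
    by right; right; right; left;
    apply: (loop_sub_matroid_variety quad_labels8 hM h8 (n0 loop8_realizable)).
  have [g9|g9] := eqVneq (vec g 9) 0.
    by right; right; right; right; left;
    apply: (loop_sub_matroid_variety quad_labels9 hM h9 (n0 loop9_realizable)).
  by have [h|h] := pascal_cover hg g7 g8 g9; [left|right; left].
have loop i l : pascal_dependence l -> loop_dependence i l.
  by rewrite /loop_dependence => ->; rewrite orbT.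
move=> [|[|[|[|[|[]]]]]].
- exact: (matroid_variety_sub hM).
- apply: (matroid_variety_sub dependence_uniform) => l /orP[/ltnW//|].
  by case/pascal_triples_subseq/andP => _ /eqP l3; rewrite /line_dependence l3.
- exact: (matroid_variety_sub h7 (loop 7%N)).
- exact: (matroid_variety_sub h8 (loop 8%N)).
- exact: (matroid_variety_sub h9 (loop 9%N)).
Qed.

Let not_in_loop i q0 q1 q2 q3 p0 p1 p2 p3 N e :
  quad_labels i q0 q1 q2 q3 p0 p1 p2 p3 -> dependence N (loop_dependence i) ->
  nth (0, 0, 0) e i.-1 != (0, 0, 0) -> ~ matroid_variety K N (configZ K e).
Proof.
move=> hq hN e0 h; case/negP: e0; rewrite -(of_vecZ0 K).
rewrite -vec_configZ ?(loop_label hq) //; apply/eqP; apply: matroid_variety_loop h => g'.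
exact: (realization_loop hq hN).
Qed.

Let not_in_uniform e a b c : uniq [:: a; b; c] -> all (mem (iota 1 9)) [:: a; b; c] ->
  det3Z (nth (0, 0, 0) e a.-1) (nth (0, 0, 0) e b.-1) (nth (0, 0, 0) e c.-1) != 0 ->
  ~ matroid_variety K (uniform 'I_9 2) (configZ K e).
Proof.
move=> u al n h; have := uniform_variety_det3 h u al; case/and4P: al => ha hb hc _.
by rewrite !vec_configZ // det3_of_vecZ => /eqP; rewrite intr_eq0; apply/negP.
Qed.

Let diagonalZ (e : seq (int * int * int)) a b c d :=
  let v k := nth (0, 0, 0) e k.-1 in
  crossZ (crossZ (v a) (v b)) (crossZ (v c) (v d)).

Let not_in_pascal e :
  det3Z (diagonalZ e 1 5 2 4) (diagonalZ e 1 6 3 4) (diagonalZ e 2 6 3 5) != 0 ->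
  ~ matroid_variety K M (configZ K e).
Proof.
move=> n /(pascal_variety_conic hM); rewrite /diagonal_point !vec_configZ //.
by rewrite !cross_of_vecZ det3_of_vecZ => /eqP; rewrite intr_eq0; apply/negP.
Qed.

(** The conic determinant is zero on collinear points. With [v] normal to their plane, the
    determinants of the Menelaus relation become differences of slopes. *)
Let line_point_not_in_pascal : ~ matroid_variety K M (configZ K line_point).
Proof.
move=> /(pascal_variety_menelaus hM (of_vecZ K (0, 0, 1))); rewrite !vec_configZ //.
rewrite !det3_of_vecZ -!intrM -intrB => /eqP; rewrite intr_eq0.
by apply/negP; vm_compute.
Qed.

Theorem pascal_decomposition : irreducible_decomposition (circuit_variety K M) components.
Proof.
apply: irreducible_decomposition_of pascal_circuit_varietyE _ _ _.
- by move=> Z; rewrite !inE => /or4P[|||/orP[]] /eqP->; apply: zariski_closure_closed.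
- move=> Z; rewrite !inE => /or4P[|||/orP[]] /eqP->.
  + exact: pascal_irreducible.
  + exact: uniform_irreducible.
  + exact: (loop_irreducible quad_labels7 h7 (n0 loop7_realizable)).
  + exact: (loop_irreducible quad_labels8 h8 (n0 loop8_realizable)).
  + exact: (loop_irreducible quad_labels9 h9 (n0 loop9_realizable)).
pose e i := nth [::] [:: pascal_point; line_point; loop7_point; loop8_point; loop9_point] i.
have eV i : (i < 5)%N -> nth set0 components i (configZ K (e i)).
  case: i => [|[|[|[|[|//]]]]] _; apply: sub_zariski_closure.
  - exact: pascal_realizable.
  - exact: uniform_realizable.
  - exact: loop7_realizable.
  - exact: loop8_realizable.
  - exact: loop9_realizable.
move=> i j i5 j5 ij /(_ _ (eV i i5)); case: j j5 ij => [|[|[|[|[|//]]]]] _ ij /=.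
(* The collinear point is settled here by [line_point_not_in_pascal]; the conic handles the three
   loop points. *)
- case: i i5 ij => [|[|[|[|[|//]]]]] _ // _.
  + by apply: not_in_pascal; vm_compute.
  + by apply: not_in_pascal; vm_compute.
  + by apply: not_in_pascal; vm_compute.
- case: i i5 ij => [|[|[|[|[|//]]]]] _ // _.
  + by apply: (@not_in_uniform _ 1 2 3); vm_compute.
  + by apply: (@not_in_uniform _ 1 2 3); vm_compute.
  + by apply: (@not_in_uniform _ 1 2 3); vm_compute.
  + by apply: (@not_in_uniform _ 1 2 3); vm_compute.
- apply: (not_in_loop quad_labels7 h7); by case: i i5 ij => [|[|[|[|[|//]]]]].
- apply: (not_in_loop quad_labels8 h8); by case: i i5 ij => [|[|[|[|[|//]]]]].
- apply: (not_in_loop quad_labels9 h9); by case: i i5 ij => [|[|[|[|[|//]]]]].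
Qed.

End Decomposition.

Close Scope classical_set_scope.
Close Scope ring_scope.

Theorem theorem4p20 (R : realType) (M : matroid 'I_9) (hM : is_pascal M) :
  irreducible_decomposition
    (circuit_variety R[i] M)
    [:: matroid_variety R[i] M;
        matroid_variety R[i] (uniform 'I_9 2);
        matroid_variety R[i] (make_loop M (point 7));
        matroid_variety R[i] (make_loop M (point 8));
        matroid_variety R[i] (make_loop M (point 9))].
Proof. exact: (@pascal_decomposition R[i] M hM). Qed.
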